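(* Let $p,q\ge2$ be coprime integers and let $c\in\mathbb{C}$ with $c\ne 2\cos\pi\left(\frac{ra}{p}\pm\frac{sb}{q}\right)$ for all pairs of integers $(a,b)$ with $0<a<p$, $0<b<q$, $a\equiv b\pmod 2$. Let $\varepsilon\in\{1,-1\}$ be the common sign of the adjoint Reidemeister torsions $\tau_{\mathrm{ad}\circ\rho}$ of the torus knot $K_{p,q}$ with respect to its meridian $\mu$. Then for every integer $m\ge0$, $$\varepsilon^m\sum_{\substack{[\rho]\in\mathcal{X}_2^*\\ \mathrm{tr}\,\rho(\mu)=c}}\frac{1}{(\tau_{\mathrm{ad}\circ\rho})^m}=\frac{1}{2(pq)^{m-1}}\left(\sum_{l=-\lfloor m/p\rfloor}^{\lfloor m/p\rfloor}(-1)^{pl}\binom{2m}{m+pl}\right)\left(\sum_{l=-\lfloor m/q\rfloor}^{\lfloor m/q\rfloor}(-1)^{ql}\binom{2m}{m+ql}\right)\in\frac{2}{(pq)^{m-1}}\mathbb{Z}.$$ In particular, for $m=1$ the inverse sum of the adjoint Reidemeister torsions with respect to $\mu$ is equal to $\pm2$.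
   Context: $K_{p,q}\subset S^3$ is the torus knot of type $(p,q)$, $G_{p,q}=\langle x,y\mid x^p=y^q\rangle$ its group, and $\mu=x^{-r}y^s$ its meridian, where $(r,s)$ is a fixed pair of integers with $ps-qr=1$. $\mathcal{X}_2^*$ is the set of conjugacy classes (characters) of irreducible representations $\rho\colon G_{p,q}\to\mathrm{SL}_2(\mathbb{C})$. Known facts: $\mathcal{X}_2^*$ is the disjoint union of components $\mathcal{X}^*_{2,(a,b)}$ indexed by integer pairs with $0<a<p$, $0<b<q$, $a\equiv b\pmod 2$; for $[\rho]\in\mathcal{X}^*_{2,(a,b)}$ one has $\mathrm{tr}\,\rho(x)=2\cos\frac{\pi a}{p}$, $\mathrm{tr}\,\rho(y)=2\cos\frac{\pi b}{q}$, $\rho(x^p)=\rho(y^q)=(-I)^a$, and $\mathrm{tr}\,\rho(\mu)\ne2\cos(\frac{\pi ra}{p}\pm\frac{\pi sb}{q})$; $\mathrm{tr}\,\rho(\mu)$ is a parameter on the component, so for $c$ as in the claim each component contains exactly one class with $\mathrm{tr}\,\rho(\mu)=c$. $\tau_{\mathrm{ad}\circ\rho}=\tau_{\mathrm{ad}\circ\rho}(K_{p,q},\mu)$ denotes the adjoint Reidemeister torsion, i.e. the torsion of the knot exterior with coefficients in $\mathfrak{sl}_2(\mathbb{C})$ via the adjoint representation $\mathrm{ad}\circ\rho$, with homology bases normalized by the curve $\mu$. Its known value on $\mathcal{X}^*_{2,(a,b)}$ is $$\tau_{\mathrm{ad}\circ\rho}=\varepsilon\,\frac{pq}{16\sin^2\frac{a\pi}{p}\sin^2\frac{b\pi}{q}},$$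 with a sign $\varepsilon=\pm1$ that is the same for all $[\rho]$; this may be taken as its definition.
   Formalization: The claim is proved for every integer m ≥ 1 rather than m ≥ 0: at m = 0 the left side is (p−1)(q−1)/2 and the right side is pq/2 (for p=2, q=3: 1 versus 3), so both the equality and the membership fail for all p, q. *)

(* Defs.v *)
From HB Require Import structures.
From mathcomp Require Import all_boot all_order all_algebra.
From mathcomp Require Import generic_quotient.
From mathcomp.real_closed Require Export complex.
From mathcomp Require Import all_classical all_reals all_analysis.

Set Implicit Arguments.
Unset Strict Implicit.
Unset Printing Implicit Defensive.

Import Order.TTheory GRing.Theory Num.Theory.

Local Open Scope classical_set_scope.
Local Open Scope quotient_scope.
Local Open Scope ring_scope.

(** * Groups given by generators and relations *)

(* The letter (g, false) stands for the generator g, (g, true) for its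
   inverse. *)
Definition word (X : Type) := seq (X * bool).

(* The least congruence on words that contains the relations E and makes
   every letter cancel with its formal inverse. *)
Inductive word_equiv (X : Type) (E : word X -> word X -> Prop) :
    word X -> word X -> Prop :=
| we_refl w : word_equiv E w w
| we_sym u v : word_equiv E u v -> word_equiv E v u
| we_trans u v w : word_equiv E u v -> word_equiv E v w -> word_equiv E u w
| we_cat u u' v v' : word_equiv E u u' -> word_equiv E v v' ->
    word_equiv E (u ++ v) (u' ++ v')
| we_cancel g e : word_equiv E [:: (g, e); (g, ~~ e)] [::]
| we_rel u v : E u v -> word_equiv E u v.

Definition word_inv (X : Type) (w : word X) : word X :=
  rev [seq (l.1, ~~ l.2) | l : X * bool <- w].

Section PresentedGroup.
Variables (X : choiceType) (E : word X -> word X -> Prop).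

Definition word_eqb (u v : word X) : bool := `[< word_equiv E u v >].

Lemma word_eqb_refl : reflexive word_eqb.
Proof. by move=> w; apply/asboolP; exact: we_refl. Qed.

Lemma word_eqb_sym : symmetric word_eqb.
Proof. by move=> u v; apply/asboolP/asboolP; exact: we_sym. Qed.

Lemma word_eqb_trans : transitive word_eqb.
Proof.
by move=> v u w /asboolP uv /asboolP vw; apply/asboolP; exact: we_trans uv vw.
Qed.

Canonical word_equiv_rel :=
  EquivRel word_eqb word_eqb_refl word_eqb_sym word_eqb_trans.

(* The group < X | u = v for all u, v such that E u v >. *)
Definition presented := {eq_quot word_eqb}.
HB.instance Definition _ := Choice.on presented.
HB.instance Definition _ := Quotient.on presented.


Definition pclass (w : word X) : presented := \pi_presented w.

Lemma pclassP u v : pclass u = pclass v <-> word_equiv E u v.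
Proof.
by split=> [/eqmodP/asboolP //|uv]; apply/eqmodP/asboolP.
Qed.

Lemma word_equiv_repr w : word_equiv E (repr (pclass w)) w.
Proof. by apply/pclassP; rewrite /pclass reprK. Qed.

Lemma word_invK : involutive (@word_inv X).
Proof.
move=> w; rewrite /word_inv -map_rev revK -map_comp -[RHS]map_id.
by apply: eq_map => -[g e] /=; rewrite negbK.
Qed.

Lemma word_inv_cons (l : X * bool) w : word_inv (l :: w) = word_inv w ++ [:: (l.1, ~~ l.2)].
Proof. by rewrite /word_inv /= rev_cons -cats1. Qed.

Lemma word_invV w : word_equiv E (word_inv w ++ w) [::].
Proof.
elim: w => [|[g e] w IHw] /=; first exact: we_refl.
rewrite word_inv_cons -catA; apply: we_trans IHw.
apply: we_cat; first exact: we_refl.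
apply: (@we_cat _ _ [:: (g, ~~ e); (g, e)] [::] w w); last exact: we_refl.
by rewrite -[X in [:: _; (g, X)]]negbK; exact: we_cancel.
Qed.

Lemma word_invVr w : word_equiv E (w ++ word_inv w) [::].
Proof. by rewrite -{1}[w]word_invK; exact: word_invV. Qed.

Definition pone : presented := pclass [::].
Definition pmul (g h : presented) : presented := pclass (repr g ++ repr h).
Definition pinv (g : presented) : presented := pclass (word_inv (repr g)).

Lemma pmulA : associative pmul.
Proof.
move=> f g h; apply/pclassP.
apply: (@we_trans _ _ _ (repr f ++ (repr g ++ repr h))).
  by apply: we_cat; [exact: we_refl | exact: word_equiv_repr].
rewrite catA; apply: we_cat; last exact: we_refl.
by apply: we_sym; exact: word_equiv_repr.
Qed.

Lemma pmul1g : left_id pone pmul.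
Proof.
move=> g; rewrite -[RHS]reprK; apply/pclassP.
rewrite -[X in word_equiv E _ X]cat0s; apply: we_cat; last exact: we_refl.
exact: word_equiv_repr.
Qed.

Lemma pmulg1 : right_id pone pmul.
Proof.
move=> g; rewrite -[RHS]reprK; apply/pclassP.
rewrite -[X in word_equiv E _ X]cats0; apply: we_cat; first exact: we_refl.
exact: word_equiv_repr.
Qed.

Lemma pmulVg : left_inverse pone pinv pmul.
Proof.
move=> g; apply/pclassP; apply: we_trans (word_invV (repr g)).
by apply: we_cat; [exact: word_equiv_repr | exact: we_refl].
Qed.

Lemma pmulgV : right_inverse pone pinv pmul.
Proof.
move=> g; apply/pclassP; apply: we_trans (word_invVr (repr g)).
by apply: we_cat; [exact: we_refl | exact: word_equiv_repr].
Qed.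

HB.instance Definition _ :=
  isGroup.Build presented pmulA pmul1g pmulg1 pmulVg pmulgV.

End PresentedGroup.

Definition gexpz (G : groupType) (g : G) (z : int) : G :=
  match z with
  | Posz n => (g ^+ n)%g
  | Negz n => (g ^- n.+1)%g
  end.

(** * The torus knot group < x, y | x^p = y^q > and its meridian *)

(* The generator x is encoded by true, y by false. *)
Inductive torus_relation (p q : nat) : word bool -> word bool -> Prop :=
| TorusRelation :
    torus_relation p q (nseq p (true, false)) (nseq q (false, false)).

Definition torus_group (p q : nat) := presented (torus_relation p q).

Definition tx (p q : nat) : torus_group p q := pclass _ [:: (true, false)].
Definition ty (p q : nat) : torus_group p q := pclass _ [:: (false, false)].

Definition meridian (p q : nat) (r s : int) : torus_group p q :=
  (gexpz (tx p q) (- r) * gexpz (ty p q) s)%g.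

(** * Irreducible representations in SL_2(C) and their conjugacy classes *)

Section Representations.
Variables (R : realType) (p q : nat).
Local Notation rep := (torus_group p q -> 'M[R[i]]_2).

Definition is_SL2_rep (rho : rep) : Prop :=
  [/\ rho 1%g = 1%:M,
      forall g h, rho (g * h)%g = rho g *m rho h
    & forall g, \det (rho g) = 1].

Definition irreducible_rep (rho : rep) : Prop :=
  forall U : {vspace 'cV[R[i]]_2},
    (forall g (v : 'cV[R[i]]_2), v \in U -> rho g *m v \in U) ->
    U = 0%VS \/ U = fullv.

Definition irrep : set rep :=
  [set rho | is_SL2_rep rho /\ irreducible_rep rho].

Definition conj_class (rho : rep) : set rep :=
  [set rho' | exists P : 'M[R[i]]_2,
     \det P = 1 /\ forall g, rho' g = P *m rho g *m invmx P].

Definition irrep_classes : set (set rep) := [set conj_class rho | rho in irrep].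

Definition irrep_classes_trace (g : torus_group p q) (c : R[i]) :
    set (set rep) :=
  [set K | irrep_classes K /\ exists2 rho, K rho & \tr (rho g) = c].

(** * Components of the space of classes, and the adjoint torsion *)

Definition component_index (a b : nat) : Prop :=
  [/\ (0 < a < p)%N, (0 < b < q)%N & (a = b %[mod 2])%N].

(* As cos is injective on [0, pi], the traces of x and y determine a and b. *)
Definition component (a b : nat) : set (set rep) :=
  [set K | irrep_classes K /\
     exists2 rho, K rho &
       \tr (rho (tx p q)) = (2 * cos (pi * a%:R / p%:R))%:C%C /\
       \tr (rho (ty p q)) = (2 * cos (pi * b%:R / q%:R))%:C%C].

(* The index (a, b) of the component that contains K; it is meaningful for
   the classes of irreducible representations only. *)
Definition index_of (K : set rep) : nat * nat :=
  xget (0, 0)%N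
    [set ab | component_index ab.1 ab.2 /\ component ab.1 ab.2 K].

(* The adjoint Reidemeister torsion of the torus knot with respect to its
   meridian, given by its known closed formula. The sign eps, which depends on
   conventions but not on the class, is a parameter. *)
Definition adjoint_torsion (eps : R[i]) (K : set rep) : R[i] :=
  let: (a, b) := index_of K in
  eps * (p * q)%:R /
    (16 * sin (a%:R * pi / p%:R) ^+ 2 * sin (b%:R * pi / q%:R) ^+ 2)%:C%C.

End Representations.

(* In the range of summation 0 <= m + n * l, so that the absolute value only
   casts it to nat. *)
Definition alt_binom_sum (n m : nat) : int :=
  \sum_(l \in [set l : int | - (m %/ n)%N%:Z <= l <= (m %/ n)%N%:Z])
    (-1) ^ (n%:Z * l) * 'C(2 * m, absz (m%:Z + n%:Z * l))%:Z.

(* Main.v *)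
Require Import Defs.
From HB Require Import structures.
From mathcomp Require Import all_boot all_order all_algebra.
From mathcomp Require Import generic_quotient.
From mathcomp Require Import all_classical all_reals all_analysis.
From mathcomp Require Import zify ring.

Set Implicit Arguments.
Unset Strict Implicit.
Unset Printing Implicit Defensive.

Import Order.TTheory GRing.Theory Num.Theory.

Local Open Scope classical_set_scope.
Local Open Scope ring_scope.

(** For an irreducible rho with X = rho x and Y = rho y, Schur's lemma makes
    X^p = Y^q = +-I, so X and Y have eigenvalues t^(+-1) and u^(+-1) with
    t = exp(i pi a / p), u = exp(i pi b / q) and a = b mod 2.  Writing
    X = t E + t^-1 (1 - E) and Y = u F + u^-1 (1 - F) with idempotents E and F,
    the number tau = tr (E F) determines rho up to conjugation, rho is
    irreducible iff tau is neither 0 nor 1, and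
      tr rho(mu) = 2 cos (pi (r a / p - s b / q)) tau
                   + 2 cos (pi (r a / p + s b / q)) (1 - tau).
    Hence each component contains exactly one class with tr rho(mu) = c.

    The sum over the components is a sum of
    (4 sin^2 (pi a / p))^m (4 sin^2 (pi b / q))^m over a = b mod 2.  One of p, q
    is odd, say p; then a |-> p - a exchanges even and odd a, so the parity
    condition halves the full double sum, which is a product.  Each factor is
    evaluated by expanding (2 - z - z^-1)^m and summing over roots of unity. *)

(** * Roots of unity as exponentials *)

Section Expi.
Variable R : realType.
Local Notation C := R[i].

Definition expi (t : R) : C := Complex (cos t) (sin t).

Lemma expi0 : expi 0 = 1.
Proof. by rewrite /expi cos0 sin0. Qed.

Lemma expiD s t : expi (s + t) = expi s * expi t.
Proof. by rewrite /expi cosD sinD; congr Complex; ring. Qed.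

Lemma expiNM t : expi (- t) * expi t = 1.
Proof. by rewrite -expiD addNr expi0. Qed.

Lemma expi_neq0 t : expi t != 0.
Proof.
by apply/eqP => t0; have := expiNM t; rewrite t0 mulr0 => /esym/eqP; rewrite oner_eq0.
Qed.

Lemma expiN t : expi (- t) = (expi t)^-1.
Proof. by apply: (mulIf (expi_neq0 t)); rewrite expiNM mulVf ?expi_neq0. Qed.

Lemma expi_nat n t : expi (n%:R * t) = expi t ^+ n.
Proof.
elim: n => [|n IHn]; first by rewrite mul0r expi0.
by rewrite -natr1 mulrDl mul1r expiD IHn exprSr.
Qed.

Lemma expi_int (z : int) t : expi (z%:~R * t) = expi t ^ z.
Proof.
case: z => n; first by rewrite -exprnP -expi_nat.
by rewrite NegzE mulrNz mulNr expiN -exprnN -expi_nat.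
Qed.

Lemma expi_pi : expi pi = -1.
Proof. by rewrite /expi cospi sinpi; apply/eqP; rewrite eq_complex /= oppr0 !eqxx. Qed.

Lemma expi_cos t : (2 * cos t)%:C%C = expi t + expi (- t).
Proof. by apply/eqP; rewrite /expi cosN sinN eq_complex /= subrr eqxx andbT; apply/eqP; ring. Qed.

Lemma expi_sin2 t : (4 * sin t ^+ 2)%:C%C = 2 - expi (2 * t) - expi (- (2 * t)).
Proof.
apply/eqP; rewrite /expi cosN sinN eq_complex /= [2 * t]mulr_natl cos_mulr2n.
by rewrite cos2sin2 ?opprK; apply/andP; split; apply/eqP; ring.
Qed.

Lemma sin_frac_gt0 n k : (0 < k < n)%N -> 0 < sin (pi * k%:R / n%:R : R).
Proof.
move=> /andP[k0 kn]; apply: sin_gt0_pi.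
have n0 : 0 < n%:R :> R by rewrite ltr0n; lia.
rewrite divr_gt0 ?mulr_gt0 ?pi_gt0 ?(ltr0n _ k) //=.
by rewrite ltr_pdivrMr // ltr_pM2l ?pi_gt0 // ltr_nat.
Qed.

Lemma expi_frac n k : expi (pi * k%:R / n%:R) = expi (pi / n%:R) ^+ k.
Proof. by rewrite -expi_nat; congr expi; ring. Qed.

Lemma expi_fracn n : (0 < n)%N -> expi (pi / n%:R) ^+ n = -1.
Proof.
by move=> n0; rewrite -expi_frac mulfK ?expi_pi // pnatr_eq0; lia.
Qed.

Lemma expi_frac_real n k : (0 < k < n)%N ->
  expi (pi / n%:R) ^+ k != 1 /\ expi (pi / n%:R) ^+ k != -1.
Proof.
move=> kn; rewrite -expi_frac /expi; have /lt0r_neq0 s0 := sin_frac_gt0 kn.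
by rewrite !eq_complex /= oppr0 (negPf s0) !andbF.
Qed.

(** Let m be the order of w = exp(i pi / n); it divides 2n because w^n = -1. By [expi_frac_real],
    w^k is neither 1 nor -1 for 0 < k < n. This excludes m < n directly, and n < m < 2n because then
    w^(m - n) = -1; the case m = n contradicts w^n = -1. *)
Lemma expi_prim n : (0 < n)%N -> (2 * n).-primitive_root (expi (pi / n%:R)).
Proof.
move=> n0; set w := expi _.
have wn : w ^+ n = -1 by exact: expi_fracn.
have w2n : w ^+ (2 * n) = 1 by rewrite mulnC exprM wn sqrrN expr1n.
have [|m pm md] := prim_order_exists _ w2n; first by lia.
have m0 := prim_order_gt0 pm; have wm := prim_expr_order pm.
suff -> : (2 * n = m)%N by [].
have [m2n|] := ltnP m (2 * n); last by have := dvdn_leq _ md; lia.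
have [mn|nm|mn] := ltngtP m n.
- have [|/eqP] := @expi_frac_real n m _; first by lia.
  by [].
- have [|_ /eqP[]] := @expi_frac_real n (m - n) _; first by lia.
  rewrite -/w; have : w ^+ (m - n + n) = 1 by rewrite subnK ?wm // ltnW.
  by rewrite exprD wn mulrN1 => /(canRL (@opprK _)).
- by move: wm; rewrite mn wn => /eqP; rewrite -subr_eq0 -opprD oppr_eq0 -(natrD _ 1 1) pnatr_eq0.
Qed.

Lemma expi_root n (z : C) : (0 < n)%N -> z ^+ (2 * n) = 1 -> z <> 1 -> z <> -1 ->
  exists2 k, (0 < k < n)%N & z = expi (pi * k%:R / n%:R) \/ z = expi (- (pi * k%:R / n%:R)).
Proof.
move=> n0 zn z1 zN1.
have [[k kn] /= zk] := prim_rootP (expi_prim n0) zn.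
have wn : expi (pi / n%:R) ^+ n = -1 by exact: expi_fracn.
have k0 : k != 0%N by apply: contra_notN z1 => /eqP k0; rewrite zk k0.
have kn' : k != n by apply: contra_notN zN1 => /eqP kn1; rewrite zk kn1.
have [lkn|nk|/eqP] := ltngtP k n; last by rewrite (negPf kn').
  by exists k; [lia | left; rewrite expi_frac].
(* Exponents above n are folded back below n by inverting the root. *)
exists (2 * n - k)%N; first by lia.
right; rewrite expiN expi_frac zk.
apply: (@mulIf _ (expi (pi / n%:R) ^+ (2 * n - k))); first by rewrite expf_neq0 ?expi_neq0.
rewrite mulVf ?expf_neq0 ?expi_neq0 // -exprD subnKC; last by lia.
by rewrite mulnC exprM wn sqrrN expr1n.
Qed.

Definition frac_expi n k : C := expi (pi * k%:R / n%:R).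

Lemma frac_expi_neq0 n k : frac_expi n k != 0.
Proof. exact: expi_neq0. Qed.

Lemma frac_expi_exprn n k : (0 < n)%N -> frac_expi n k ^+ n = (-1) ^+ k.
Proof. by move=> n0; rewrite /frac_expi expi_frac -exprM mulnC exprM expi_fracn. Qed.

Lemma frac_expi_expr2n n k : (0 < n)%N -> frac_expi n k ^+ (2 * n) = 1.
Proof. by move=> n0; rewrite mulnC exprM frac_expi_exprn // sqrr_sign. Qed.

Lemma frac_expi_cos n k :
  (2 * cos (pi * k%:R / n%:R))%:C%C = frac_expi n k + (frac_expi n k)^-1.
Proof. by rewrite expi_cos expiN. Qed.

Lemma frac_expi_subV n k : (0 < k < n)%N -> frac_expi n k - (frac_expi n k)^-1 != 0.
Proof.
move=> kn; rewrite /frac_expi -expiN /expi cosN sinN eq_complex /= opprK.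
by rewrite negb_and; apply/orP; right; rewrite -mulr2n mulrn_eq0 /= lt0r_neq0 ?sin_frac_gt0.
Qed.

Lemma cos_frac_inj n a b : (0 < a < n)%N -> (0 < b < n)%N ->
  cos (pi * a%:R / n%:R : R) = cos (pi * b%:R / n%:R) -> a = b.
Proof.
move=> an bn.
have n0 : 0 < n%:R :> R by rewrite ltr0n; lia.
have itv k : (0 < k < n)%N -> pi * k%:R / n%:R \in `[0, pi : R].
  move=> kn; rewrite in_itv /= divr_ge0 ?mulr_ge0 ?pi_ge0 //=.
  by rewrite ler_pdivrMr // ler_pM2l ?pi_gt0 // ler_nat; lia.
move=> /(cos_inj (itv _ an) (itv _ bn)) /(divIf (lt0r_neq0 n0)).
by move=> /(mulfI (lt0r_neq0 (pi_gt0 _))) /eqP; rewrite eqr_nat => /eqP.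
Qed.

(** This is a geometric sum with ratio w^(2k), an n-th root of unity that equals 1 exactly when n
    divides k. *)
Lemma expi_root_sum n k : (0 < n)%N ->
  \sum_(a < n) expi (pi / n%:R) ^+ (2 * a * k) = (n * (n %| k)%N)%:R.
Proof.
move=> n0; set w := expi _.
under eq_bigr => a _ do rewrite -mulnA mulnCA mulnC exprM.
have -> : (n %| k)%N = (w ^+ (2 * k) == 1).
  by rewrite -(prim_order_dvd (expi_prim n0)) dvdn_pmul2l.
case: eqP => [->|/eqP w1].
  by rewrite muln1 (eq_bigr (fun=> 1)) ?sumr_const ?card_ord // => i _; rewrite expr1n.
rewrite muln0; apply: (@mulfI _ (w ^+ (2 * k) - 1)); first by rewrite subr_eq0.
rewrite -subrX1 mulr0 -exprM mulnAC exprM (prim_expr_order (expi_prim n0)).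
by rewrite expr1n subrr.
Qed.

End Expi.

(** * Power sums of sines *)

Section Sums.

(** Folding about the middle index serves twice: for the symmetric range of [alt_binom_sum] and for
    the binomial expansion of (1 - y)^(2m). *)
Lemma big_nat_center (V : nmodType) (F : nat -> V) m :
  \sum_(0 <= j < (2 * m).+1) F j =
    F m + \sum_(1 <= i < m.+1) (F (m + i)%N + F (m - i)%N).
Proof.
rewrite (@big_cat_nat _ _ _ m) //=; last by lia.
rewrite (@big_ltn _ _ _ m) /=; last by lia.
rewrite addrCA big_split /= [X in _ = _ + X]addrC; congr (_ + (_ + _)).
  rewrite big_nat_rev /= big_add1 /=; apply: eq_big_nat => i _.
  by congr F; lia.
rewrite -{1}[m.+1]add1n big_addn.
have -> : ((2 * m).+1 - m = m.+1)%N by lia.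
by apply: eq_bigr => i _; congr F; lia.
Qed.

Lemma sum_multiples (V : nmodType) (G : nat -> V) n m : (0 < n)%N ->
  \sum_(1 <= i < m.+1 | (n %| i)%N) G i = \sum_(1 <= l < (m %/ n).+1) G (n * l)%N.
Proof.
move=> n0; elim: m => [|m IHm]; first by rewrite div0n !big_geq.
rewrite big_mkcond big_nat_recr //= -big_mkcond IHm divnS //.
case: ifP => [nm|_]; last by rewrite addr0 add0n.
rewrite add1n [RHS]big_nat_recr //=; congr (_ + G _).
by have := divnS m n0; rewrite nm add1n => <-; rewrite mulnC divnK.
Qed.

Lemma bin_centerN m i : (i <= m)%N -> 'C(2 * m, m - i) = 'C(2 * m, m + i).
Proof.
by move=> im; rewrite -[LHS]bin_sub; [congr binomial|]; lia.
Qed.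

Definition binom_half_sum n m : int :=
  \sum_(1 <= l < (m %/ n).+1) (-1) ^+ (n * l) * 'C(2 * m, m + n * l)%:Z.

(** The terms at l and -l agree, by the symmetry of the sign and of the binomial coefficients, so
    each pair contributes twice the term with l > 0. *)
Lemma alt_binom_sumE n m : (0 < n)%N ->
  alt_binom_sum n m = 'C(2 * m, m)%:Z + 2 * binom_half_sum n m.
Proof.
move=> n0; rewrite /alt_binom_sum; set k := (m %/ n)%N.
(* The shift by k turns the integer range from -k to k into the naturals from 0 to 2k, centred at j
   = k. *)
pose h (j : nat) : int := j%:Z - k%:Z.
rewrite (@reindex_fsbig _ _ _ _ _ h `I_(2 * k).+1); last first.
  split=> [j|i j _ _|l]; rewrite /h /=; first by lia.
    by lia.
  by move=> lk; exists (absz (l + k%:Z)); lia.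
rewrite -fsbig_ord -(big_mkord xpredT
  (fun j => (-1) ^ (n%:Z * h j) * 'C(2 * m, absz (m%:Z + n%:Z * h j))%:Z)).
rewrite big_nat_center /h subrr mulr0 addr0 mul1r; congr (_ + _).
rewrite /binom_half_sum mulr_sumr; apply: eq_big_nat => l; rewrite ltnS => /andP[l1 lk].
(* This bound makes the truncated difference [m - n * l] exact, so that it agrees with the absolute
   value. *)
have nlm : (n * l <= m)%N.
  by apply: leq_trans (leq_trunc_div m n); rewrite mulnC leq_pmul2r.
have -> : (k + l)%:Z - k%:Z = l%:Z by lia.
have -> : (k - l)%:Z - k%:Z = - l%:Z by lia.
rewrite mulrN -exprz_inv invrN1 -PoszM -exprnP.
have -> : absz (m%:Z + (n * l)%:Z) = (m + n * l)%N by lia.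
have -> : absz (m%:Z - (n * l)%:Z) = (m - n * l)%N by lia.
by rewrite bin_centerN //; ring.
Qed.

(** By Pascal's rule and symmetry, the central coefficient C(2m + 2, m + 1) is twice C(2m + 1, m);
    the other terms already come in equal pairs. *)
Lemma alt_binom_sum_even n m : (0 < n)%N -> (0 < m)%N ->
  exists k : int, alt_binom_sum n m = 2 * k.
Proof.
case: m => // m n0 _; rewrite alt_binom_sumE //.
exists ('C(2 * m + 1, m)%:Z + binom_half_sum n m.+1).
have -> : (2 * m.+1 = (2 * m + 1).+1)%N by lia.
rewrite binS -[X in ('C(_, X) + _)%N](_ : 2 * m + 1 - m = _)%N; last by lia.
by rewrite bin_sub ?PoszD; [ring | lia].
Qed.

(** Since (2 - y - y^-1) y = -(1 - y)^2, multiplying by y^m reduces the claim to the expansion of (1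
    - y)^(2m), folded about its middle term. *)
Lemma central_binom_expansion (F : fieldType) (y : F) m : y != 0 ->
  (2 - y - y^-1) ^+ m = 'C(2 * m, m)%:R +
    \sum_(1 <= i < m.+1) (-1) ^+ i * 'C(2 * m, m + i)%:R * (y ^+ i + y ^- i).
Proof.
move=> y0; apply: (mulIf (expf_neq0 m y0)).
have -> : (2 - y - y^-1) ^+ m * y ^+ m = (-1) ^+ m * (1 - y) ^+ (2 * m).
  by rewrite exprM -!exprMn; congr (_ ^+ _); field.
rewrite exprBn -(big_mkord xpredT (fun j => (-1) ^+ j * 1 ^+ (2 * m - j) * y ^+ j *+ 'C(2 * m, j))).
rewrite big_nat_center mulrDl mulrDr mulr_suml mulr_sumr; congr (_ + _).
  by rewrite expr1n mulr1 -mulrnAr mulrA -expr2 -exprM mulnC exprM sqrrN !expr1n mul1r mulr_natl.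
apply: eq_big_nat => i; rewrite ltnS => /andP[i1 im].
rewrite !expr1n bin_centerN // !mulr1.
have ym : y ^+ m = y ^+ (m - i) * y ^+ i by rewrite -exprD subnK.
have -> : (-1) ^+ (m - i) = (-1) ^+ (m + i) :> F.
  by rewrite -signr_odd -[RHS]signr_odd; congr ((-1) ^+ nat_of_bool _); lia.
have -> : (-1) ^+ (m + i) = (-1) ^+ m * (-1) ^+ i :> F by rewrite exprD.
have m1 : (-1) ^+ m * (-1) ^+ m = 1 :> F by rewrite -exprD addnn -muln2 mulnC exprM sqrrN !expr1n.
transitivity (((-1) ^+ m * (-1) ^+ m) *
  ((-1) ^+ i * 'C(2 * m, m + i)%:R * (y ^+ (m + i) + y ^+ (m - i))) : F).
  rewrite -[_ * y ^+ (m + i) *+ _]mulr_natr -[_ * y ^+ (m - i) *+ _]mulr_natr.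
  by move: 'C(_, _)%:R ((-1) ^+ m) ((-1) ^+ i) => b d e; ring.
rewrite m1 mul1r exprD ym.
have := expf_neq0 i y0; move: (y ^+ i) (y ^+ (m - i)) 'C(_, _)%:R ((-1) ^+ i) => u v b e u0.
by field.
Qed.

Variable R : realType.
Local Notation C := R[i].

(** Up to the constant factor [(eps * (p * q)%:R) ^- m], the m-th power of the inverse torsion on
    component (a, b) is the product of the weights for p, a and for q, b. *)
Definition sin_weight n m a : R := (4 * sin (pi * a%:R / n%:R) ^+ 2) ^+ m.

Lemma sin_weight0 n m : (0 < m)%N -> sin_weight n m 0 = 0.
Proof. by case: m => // m _; rewrite /sin_weight mulr0 mul0r sin0 expr0n mulr0 expr0n. Qed.

Lemma sin_weight_sub n m a : (a <= n)%N -> (0 < n)%N ->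
  sin_weight n m (n - a) = sin_weight n m a.
Proof.
move=> an n0; rewrite /sin_weight natrB // mulrBr mulrBl mulfK ?pnatr_eq0 -?lt0n //.
by rewrite sinB sinpi cospi; congr ((4 * _) ^+ _); ring.
Qed.

(** Each z = w^(2a) satisfies z^n = 1, so z^-i = z^((n - 1) i); and n divides (n - 1) i iff it
    divides i, as n - 1 and n are coprime. *)
Lemma expi_root_sum_inv n i : (0 < n)%N ->
  \sum_(a < n) (expi (pi / n%:R) ^+ (2 * a * i))^-1 = (n * (n %| i)%N)%:R :> C.
Proof.
move=> n0; have -> : (n %| i)%N = (n %| n.-1 * i)%N.
  by rewrite Gauss_dvdr // coprime_sym; case: n n0 => // n _; rewrite coprimenS.
rewrite -expi_root_sum //; apply: eq_bigr => a _.
apply: (mulIf (expf_neq0 (2 * a * i) (expi_neq0 (pi / n%:R : R)))).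
rewrite mulVf ?expf_neq0 ?expi_neq0 // -exprD.
have -> : (2 * a * (n.-1 * i) + 2 * a * i = 2 * n * (a * i))%N.
  by have := prednK n0; move: (n.-1) (nat_of_ord a) => u v; nia.
by rewrite exprM (prim_expr_order (expi_prim R n0)) expr1n.
Qed.

(** Root-of-unity filter: with y = exp(2 pi i a / n) each weight is a Laurent polynomial in y, and
    summing over a kills y^i and y^-i unless n divides i, when each contributes n. *)
Lemma sin_weight_sum n m : (0 < n)%N -> (0 < m)%N ->
  \sum_(1 <= a < n) (sin_weight n m a)%:C%C = n%:R * (alt_binom_sum n m)%:~R :> C.
Proof.
(* The term a = 0 vanishes since m > 0, so it can be added to obtain a sum over all n-th roots of
   unity. *)
move=> n0 m0; transitivity (\sum_(0 <= a < n) (sin_weight n m a)%:C%C : C).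
  by rewrite [RHS]big_ltn // sin_weight0 // add0r.
rewrite big_mkord.
under eq_bigr => a _.
  rewrite /sin_weight rmorphXn /= expi_sin2 expiN.
  rewrite (_ : 2 * _ = (2 * a)%:R * (pi / n%:R)); last by rewrite natrM; ring.
  rewrite expi_nat central_binom_expansion ?expf_neq0 ?expi_neq0 //.
  under eq_bigr => i _ do rewrite -exprM.
  over.
rewrite big_split /= sumr_const card_ord exchange_big /=.
under eq_bigr => i _ do
  rewrite -mulr_sumr big_split /= expi_root_sum // expi_root_sum_inv //.
rewrite alt_binom_sumE // /binom_half_sum rmorphD /= mulrDr mulr_natl; congr (_ + _).
rewrite rmorphM /= rmorph_sum /=
  -(sum_multiples (fun i => ((-1) ^+ i * 'C(2 * m, m + i)%:Z)%:~R)) //.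
rewrite [in RHS]big_mkcond /= !mulr_sumr; apply: eq_bigr => i _.
case: (n %| i)%N; last by rewrite muln0 addr0 !mulr0.
by rewrite muln1 rmorphM rmorphXn rmorphN1 /= !pmulrn; ring.
Qed.

Lemma parity_sum_odd (V : nmodType) (f : nat -> V) n : odd n ->
  (forall a, (0 < a < n)%N -> f (n - a)%N = f a) ->
  \sum_(1 <= a < n | odd a) f a = \sum_(1 <= a < n | ~~ odd a) f a.
Proof.
move=> on fn; rewrite [LHS]big_mkcond big_nat_rev [RHS]big_mkcond /=.
apply: eq_big_nat => a an; rewrite add1n subSS oddB ?on; last by lia.
by case: (odd a) => //=; rewrite fn.
Qed.

(** Let S0, S1 and T0, T1 be the sums of f and g over even and odd indices. The left side is 2 (S0
    T0 + S1 T1), the right side (S0 + S1)(T0 + T1); they agree as soon as S0 = S1 or T0 = T1, which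
    [parity_sum_odd] supplies for the odd one of p and q. *)
Lemma parity_sum (f g : nat -> C) p q : odd p || odd q ->
  (forall a, (0 < a < p)%N -> f (p - a)%N = f a) ->
  (forall a, (0 < a < q)%N -> g (q - a)%N = g a) ->
  2 * \sum_(1 <= a < p) \sum_(1 <= b < q | odd a == odd b) f a * g b =
    (\sum_(1 <= a < p) f a) * (\sum_(1 <= b < q) g b).
Proof.
move=> opq fp gq; under eq_bigr => a _ do rewrite -mulr_sumr.
have split_parity e : \sum_(1 <= a < p | odd a == e) f a * \sum_(1 <= b < q | odd a == odd b) g b =
    (\sum_(1 <= a < p | odd a == e) f a) * \sum_(1 <= b < q | e == odd b) g b.
  by rewrite mulr_suml; apply: eq_bigr => a /eqP ->.
have sum1 n (h : nat -> C) : \sum_(1 <= a < n | odd a == true) h a = \sum_(1 <= a < n | odd a) h a.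
  by apply: eq_bigl => b; rewrite eqb_id.
have sum0 n (h : nat -> C) : \sum_(1 <= a < n | odd a == false) h a = \sum_(1 <= a < n | ~~ odd a) h a.
  by apply: eq_bigl => b; rewrite eqbF_neg.
rewrite (bigID odd) /= -sum1 -sum0 !split_parity sum1 sum0.
have -> : \sum_(1 <= i < q | false == odd i) g i = \sum_(1 <= i < q | ~~ odd i) g i.
  by apply: eq_bigl => b; case: odd.
rewrite (bigID odd xpredT f) (bigID odd xpredT g) /=.
have -> : \sum_(1 <= i < q | true == odd i) g i = \sum_(1 <= i < q | odd i) g i.
  by apply: eq_bigl => b; case: odd.
by case/orP: opq => o; [rewrite (parity_sum_odd o fp) | rewrite (parity_sum_odd o gq)]; ring.
Qed.

End Sums.

(** * Matrices of size 2 and representations of the torus knot group *)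

Section Matrices.
Variable F : fieldType.
Implicit Types A B : 'M[F]_2.

Lemma forall_ord2 (P : 'I_2 -> Prop) : P 0 -> P 1 -> forall i, P i.
Proof.
move=> P0 P1 [[|[|i]] //= li].
  by rewrite (_ : Ordinal _ = 0) //; apply: val_inj.
by rewrite (_ : Ordinal _ = 1) //; apply: val_inj.
Qed.

Lemma big_ord2 (V : nmodType) (f : 'I_2 -> V) : \sum_(i < 2) f i = f 0 + f 1.
Proof.
rewrite !big_ord_recl big_ord0 addr0; congr (f _ + f _).
exact: val_inj.
Qed.

Lemma mx2P n (B C : 'M[F]_(2, n)) :
  (forall j, B 0 j = C 0 j) -> (forall j, B 1 j = C 1 j) -> B = C.
Proof. by move=> h0 h1; apply/matrixP => i j; move: i; apply: forall_ord2. Qed.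

Lemma mulmx2E m n (A : 'M[F]_(m, 2)) (B : 'M[F]_(2, n)) i j :
  (A *m B) i j = A i 0 * B 0 j + A i 1 * B 1 j.
Proof. by rewrite mxE big_ord2. Qed.

Lemma mxtrace2E A : \tr A = A 0 0 + A 1 1.
Proof. exact: big_ord2. Qed.

Lemma det_mx2E A : \det A = A 0 0 * A 1 1 - A 0 1 * A 1 0.
Proof.
rewrite (expand_det_row _ 0) big_ord2 /cofactor !det_mx11 !mxE /=.
rewrite expr0 expr1 mulN1r mul1r mulrN.
by congr (_ * A _ _ - _ * A _ _); apply: val_inj.
Qed.

Definition mx2 (a b c d : F) : 'M[F]_2 :=
  \matrix_(i, j) if i == 0 then if j == 0 then a else b else if j == 0 then c else d.

Lemma mx2E A : A = mx2 (A 0 0) (A 0 1) (A 1 0) (A 1 1).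
Proof. by apply: mx2P => j; rewrite mxE /=; move: j; apply: forall_ord2. Qed.

Lemma eq_mx2 A B : A 0 0 = B 0 0 -> A 0 1 = B 0 1 -> A 1 0 = B 1 0 -> A 1 1 = B 1 1 -> A = B.
Proof. by move=> h1 h2 h3 h4; rewrite [A]mx2E [B]mx2E h1 h2 h3 h4. Qed.

Lemma Cayley_Hamilton2 A : A *m A = \tr A *: A - (\det A)%:M.
Proof.
by apply: eq_mx2; rewrite mulmx2E !mxE mxtrace2E det_mx2E /=; ring.
Qed.

Lemma det0_ker n (A : 'M[F]_n) : \det A = 0 -> exists2 v : 'cV[F]_n, v != 0 & A *m v = 0.
Proof.
rewrite -det_tr => /eqP/det0P[v v0 vA]; exists v^T; first by rewrite trmx_eq0.
by apply: trmx_inj; rewrite trmx_mul trmxK vA trmx0.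
Qed.

End Matrices.

(** * Words and induction in the torus knot group *)

Section TorusGroup.
Variables p q : nat.
Local Notation G := (torus_group p q).

Lemma pclass_cons (X : choiceType) (E : word X -> word X -> Prop) l w :
  pclass E (l :: w) = (pclass E [:: l] * pclass E w)%g.
Proof.
apply/pclassP; rewrite -cat1s.
by apply: we_cat; apply: we_sym; exact: word_equiv_repr.
Qed.

Lemma pclass_inv (X : choiceType) (E : word X -> word X -> Prop) x :
  pclass E [:: (x, true)] = ((pclass E [:: (x, false)])^-1)%g.
Proof.
apply/eqP; rewrite -mulg_eq1 -pclass_cons; apply/eqP/pclassP.
exact: (@we_cancel _ _ x true).
Qed.

Lemma pclass_nseq (X : choiceType) (E : word X -> word X -> Prop) l n :
  pclass E (nseq n l) = (pclass E [:: l] ^+ n)%g.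
Proof. by elim: n => [|n IHn] //=; rewrite pclass_cons IHn expgS. Qed.

Lemma torus_relationE : (tx p q ^+ p)%g = (ty p q ^+ q)%g.
Proof. by rewrite -!pclass_nseq; apply/pclassP/we_rel. Qed.

(** Every element is the class of a word in the generators and their inverses. This principle
    carries conjugation, common eigenvectors and commutation from x and y to the whole group. *)
Lemma torus_ind (P : G -> Prop) :
  P 1%g -> P (tx p q) -> P (ty p q) ->
  (forall g h, P g -> P h -> P (g * h)%g) -> (forall g, P g -> P (g^-1)%g) ->
  forall g, P g.
Proof.
move=> P1 Px Py PM PV g; rewrite -[g]reprK.
change (P (pclass _ (repr g))).
elim: (repr g) => [//|[x e] w IHw]; rewrite pclass_cons.
apply: PM => //; case: e x => -[]; rewrite ?pclass_inv //; exact: PV.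
Qed.

End TorusGroup.

(** * Conjugacy, common eigenvectors and Schur's lemma *)

Section Reps.
Variables (R : realType) (p q : nat).
Local Notation C := R[i].
Local Notation G := (torus_group p q).
Local Notation rep := (G -> 'M[C]_2).
Local Notation x := (tx p q).
Local Notation y := (ty p q).
Implicit Types rho : rep.

Lemma SL2_unit (A : 'M[C]_2) : \det A = 1 -> A \is a GRing.unit.
Proof. by move=> dA; rewrite -[_ \is a _]/(A \in unitmx) unitmxE dA unitr1. Qed.

Lemma SL2_repV rho g : is_SL2_rep rho -> rho (g^-1)%g = (rho g)^-1.
Proof.
move=> [r1 rM rd]; apply: (mulIr (SL2_unit (rd g))).
by rewrite mulVr ?SL2_unit // -mulmxE -rM mulVg.
Qed.

Lemma SL2_repX rho g n : is_SL2_rep rho -> rho (g ^+ n)%g = rho g ^+ n.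
Proof.
move=> [r1 rM rd]; elim: n => [|n IHn]; first by rewrite r1.
by rewrite expgS rM IHn exprS.
Qed.

Lemma SL2_repXz rho g z : is_SL2_rep rho -> rho (gexpz g z) = rho g ^ z.
Proof.
by move=> r; case: z => n /=; rewrite ?SL2_repV // SL2_repX // NegzE exprnN.
Qed.

Lemma SL2_rep_relation rho : is_SL2_rep rho -> rho x ^+ p = rho y ^+ q.
Proof. by move=> r; rewrite -!SL2_repX // torus_relationE. Qed.

Lemma SL2_rep_meridian rho r s : is_SL2_rep rho ->
  rho (meridian p q r s) = rho x ^ (- r) * rho y ^ s.
Proof. by move=> h; have [_ rM _] := h; rewrite rM !SL2_repXz. Qed.

Lemma conj_class_gen rho rho' P : is_SL2_rep rho -> is_SL2_rep rho' -> \det P = 1 ->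
  rho' x = P * rho x * P^-1 -> rho' y = P * rho y * P^-1 ->
  forall g, rho' g = P * rho g * P^-1.
Proof.
move=> hr hr' /SL2_unit uP hx hy; apply: torus_ind; [|exact: hx|exact: hy| |].
- by have [-> _ _] := hr; have [-> _ _] := hr'; rewrite mulr1 mulrV.
- move=> g h Pg Ph; have [_ -> _] := hr'; have [_ -> _] := hr.
  by rewrite -!mulmxE Pg Ph !mulmxE !mulrA mulrVK.
- move=> g Pg; rewrite !SL2_repV // Pg.
  have [_ _ /(_ g)/SL2_unit ug] := hr.
  have uPg : P * rho g \is a GRing.unit by rewrite unitrMr.
  have uPV : P^-1 \is a GRing.unit by rewrite unitrV.
  by rewrite (invrM uPg uPV) invrK (invrM uP ug) mulrA.
Qed.

Lemma conj_class_refl rho : conj_class rho rho.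
Proof. by exists 1%:M; rewrite det1; split=> // g; rewrite invmx1 mul1mx mulmx1. Qed.

Lemma conj_class_eq rho rho' : conj_class rho rho' -> conj_class rho = conj_class rho'.
Proof.
move=> [P [dP hP]]; have uP := SL2_unit dP; apply/seteqP; split=> [f [Q [dQ hQ]]|f [Q [dQ hQ]]].
- have uQ := SL2_unit dQ; exists (Q * P^-1); split.
    by rewrite det_mulmx det_inv dP dQ invr1 mulr1.
  move=> g; rewrite hQ hP !mulmxE -[invmx (_ * _)]/((Q * P^-1)^-1).
  by rewrite invrM ?unitrV // invrK -[invmx P]/(P^-1) -[invmx Q]/(Q^-1) !mulrA !mulrVK.
- have uQ := SL2_unit dQ; exists (Q * P); split; first by rewrite det_mulmx dP dQ mulr1.
  move=> g; rewrite hQ hP !mulmxE -[invmx (Q * P)]/((Q * P)^-1).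
  by rewrite invrM // -[invmx P]/(P^-1) -[invmx Q]/(Q^-1) !mulrA.
Qed.

Lemma conj_class_trace rho rho' g : conj_class rho rho' -> \tr (rho' g) = \tr (rho g).
Proof.
move=> [P [dP hP]]; rewrite hP mxtrace_mulC mulmxA mulVmx ?mul1mx //.
exact: SL2_unit dP.
Qed.

(** A common eigenvector of the two generators is an eigenvector of every group element, so it spans
    an invariant line, a subspace of dimension 1. *)
Lemma reducible_eigenvector rho (v : 'cV[C]_2) a b : is_SL2_rep rho -> v != 0 ->
  rho x *m v = a *: v -> rho y *m v = b *: v -> ~ irreducible_rep rho.
Proof.
move=> hr v0 hx hy irr; have [r1 rM rd] := hr.
have eig g : exists c, rho g *m v = c *: v.
  move: g; apply: torus_ind; [|by exists a|by exists b| |].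
  - by exists 1; rewrite r1 mul1mx scale1r.
  - move=> g h [c hg] [d hd]; exists (d * c).
    by rewrite rM -mulmxA hd -scalemxAr hg scalerA.
  - move=> g [c hg]; exists c^-1.
    have uV : rho (g^-1)%g *m rho g = 1%:M by rewrite -rM mulVg.
    have : v = c *: (rho (g^-1)%g *m v) by rewrite scalemxAr -hg mulmxA uV mul1mx.
    have [->|c0] := eqVneq c 0; first by rewrite scale0r => v0'; rewrite v0' eqxx in v0.
    by move=> {2}->; rewrite scalerA mulVf // scale1r.
have [g u|U0|Uf] := irr <[v]>%VS.
- case: (eig g) => c hg /vlineP[k ->]; apply/vlineP; exists (k * c).
  by rewrite -scalemxAr hg scalerA.
- by have := memv_line v; rewrite U0 memv0 (negPf v0).
- by have := dim_vline v; rewrite Uf dimvf v0 /dim /= .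
Qed.

(** The quadratic formula applied to the characteristic polynomial; every complex number has a
    square root. *)
Lemma exists_eigenvalue2 (Z : 'M[C]_2) : exists t, \det (Z - t%:M) = 0.
Proof.
pose s : C := sqrtc ((\tr Z) ^+ 2 - 4 * \det Z).
have s2 : s ^+ 2 = (\tr Z) ^+ 2 - 4 * \det Z by exact: sqr_sqrtc.
exists ((\tr Z + s) / 2); move: s2; rewrite !det_mx2E mxtrace2E !mxE /= => s2.
apply: (@mulfI _ 4); first by rewrite pnatr_eq0.
have : s ^+ 2 - ((Z 0 0 + Z 1 1) ^+ 2 - 4 * (Z 0 0 * Z 1 1 - Z 0 1 * Z 1 0)) = 0.
  by rewrite s2 subrr.
by move=> s2'; rewrite mulr0 -s2'; field.
Qed.

(** Schur's lemma: Z commutes with the whole image, so the kernel of Z - t, for an eigenvalue t of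
    Z, is a nonzero invariant subspace and hence everything. *)
Lemma irreducible_central rho Z : is_SL2_rep rho -> irreducible_rep rho ->
  Z * rho x = rho x * Z -> Z * rho y = rho y * Z -> exists c, Z = c%:M.
Proof.
move=> hr irr Zx Zy; have [r1 rM rd] := hr.
have cent g : Z * rho g = rho g * Z.
  move: g; apply: torus_ind => //; first by rewrite r1 mulr1 mul1r.
    by move=> g h Zg Zh; rewrite rM mulmxE mulrA Zg -!mulrA Zh.
  move=> g Zg; rewrite SL2_repV //; have ug := SL2_unit (rd g).
  by apply: (mulrI ug); apply: (mulIr ug); rewrite mulrA -Zg -!mulrA mulVr // mulr1 mulrA mulrV // mul1r.
have [t tr] := exists_eigenvalue2 Z.
have [v v0 Zv] := det0_ker tr.
pose U := lker (linfun (mulmx (Z - t%:M) : 'cV[C]_2 -> 'cV[C]_2)).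
have UE u : (u \in U) = ((Z - t%:M) *m u == 0) by rewrite memv_ker lfunE.
exists t; apply/eqP; rewrite -subr_eq0; apply/eqP.
have [g u|U0|Uf] := irr U.
- rewrite !UE => /eqP Zu; rewrite mulmxA.
  have -> : (Z - t%:M) *m rho g = rho g *m (Z - t%:M).
    by rewrite mulmxBl mulmxBr !mulmxE cent -!mulmxE scalar_mxC.
  by rewrite -mulmxA Zu mulmx0.
- by move: v0; rewrite -memv0 -U0 UE Zv eqxx.
apply/matrixP => i j; have : delta_mx j 0 \in U by rewrite Uf memvf.
by rewrite UE => /eqP/matrixP/(_ i 0); rewrite -colE !mxE.
Qed.

End Reps.

(** * Spectral idempotents and the canonical form of a pair of matrices *)

Section Spectral.
Variable F : fieldType.
Implicit Types (A B E : 'M[F]_2) (t u : F).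

Lemma idempotent_expr E a b n : E * E = E ->
  (a *: E + b *: (1 - E)) ^+ n = a ^+ n *: E + b ^+ n *: (1 - E).
Proof.
move=> EE; elim: n => [|n IHn]; first by rewrite !expr0 !scale1r addrC subrK.
have E1 : E * (1 - E) = 0 by rewrite mulrBr mulr1 EE subrr.
have E2 : (1 - E) * E = 0 by rewrite mulrBl mul1r EE subrr.
have E3 : (1 - E) * (1 - E) = 1 - E by rewrite mulrBl mul1r E1 subr0.
rewrite exprS IHn mulrDl !mulrDr -!scalerAl -!scalerAr EE E1 E2 E3.
by rewrite !scaler0 addr0 add0r !scalerA -!exprS.
Qed.

Lemma idempotent_exprz E a (z : int) : a != 0 -> E * E = E ->
  (a *: E + a^-1 *: (1 - E)) ^ z = a ^ z *: E + a ^ (- z) *: (1 - E).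
Proof.
move=> a0 EE.
have E1 : E * (1 - E) = 0 by rewrite mulrBr mulr1 EE subrr.
have E2 : (1 - E) * E = 0 by rewrite mulrBl mul1r EE subrr.
have E3 : (1 - E) * (1 - E) = 1 - E by rewrite mulrBl mul1r E1 subr0.
have inv b : b != 0 -> (b *: E + b^-1 *: (1 - E)) * (b^-1 *: E + b *: (1 - E)) = 1.
  move=> b0; rewrite mulrDl !mulrDr -!scalerAl -!scalerAr EE E1 E2 E3.
  by rewrite !scaler0 addr0 add0r !scalerA mulfV // mulVf // !scale1r addrC subrK.
have unitE b : b != 0 -> (b *: E + b^-1 *: (1 - E)) \is a GRing.unit.
  move=> b0; apply/unitrP; exists (b^-1 *: E + b *: (1 - E)); split; last exact: inv.
  by have := inv b^-1; rewrite invr_eq0 invrK; apply.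
case: z => n.
  by rewrite -exprnP idempotent_expr // exprnP -exprnN exprVn.
rewrite NegzE -exprnN opprK -exprVn.
have -> : (a *: E + a^-1 *: (1 - E))^-1 = a^-1 *: E + a *: (1 - E).
  by apply: (mulrI (unitE a a0)); rewrite mulrV ?unitE // inv.
by rewrite idempotent_expr // exprVn exprnN.
Qed.

(** When A has distinct eigenvalues t and t^-1, this is the projection onto the t-eigenspace along
    the t^-1-eigenspace, written as a Lagrange interpolation polynomial in A. *)
Definition eigenproj t A : 'M[F]_2 := (t - t^-1)^-1 *: (A - t^-1%:M).

Section Eigenproj.
Variables (t : F) (A : 'M[F]_2).
Hypotheses (t0 : t != 0) (t1 : t - t^-1 != 0) (dA : \det A = 1) (tA : \tr A = t + t^-1).
Local Notation E := (eigenproj t A).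

Lemma eigenproj_idem : E * E = E.
Proof.
rewrite /eigenproj -scalerAl -scalerAr scalerA -mulmxE.
rewrite mulmxBl !mulmxBr Cayley_Hamilton2 dA tA mul_scalar_mx mul_mx_scalar mul_scalar_mx.
have t1' : t ^+ 2 - 1 != 0.
  by apply: contra_neq t1 => t2; apply: (mulfI t0); rewrite mulrBr mulfV // -expr2 t2 mulr0.
by apply: eq_mx2; rewrite !mxE /=; field; rewrite t0 -expr2.
Qed.

Lemma eigenprojE : A = t *: E + t^-1 *: (1 - E).
Proof.
have t1' : t ^+ 2 - 1 != 0.
  by apply: contra_neq t1 => t2; apply: (mulfI t0); rewrite mulrBr mulfV // -expr2 t2 mulr0.
by apply: eq_mx2; rewrite !mxE /=; field; rewrite t0 -expr2.
Qed.

Lemma eigenproj_trace : \tr E = 1.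
Proof.
rewrite /eigenproj mxtraceZ raddfB /= mxtrace_scalar tA mulr2n.
by rewrite (_ : _ - _ = t - t^-1) ?mulVf //; ring.
Qed.

Lemma eigenproj_exprz z : A ^ z = t ^ z *: E + t ^ (- z) *: (1 - E).
Proof. by rewrite {1}eigenprojE idempotent_exprz // eigenproj_idem. Qed.

End Eigenproj.

(** Both spectral idempotents E and F have trace 1, so E F and (1 - E)(1 - F) have trace tau, while
    E (1 - F) and (1 - E) F have trace 1 - tau. *)
Lemma mxtrace_eigenproj_mul A B t u (z w : int) :
  t != 0 -> t - t^-1 != 0 -> \det A = 1 -> \tr A = t + t^-1 ->
  u != 0 -> u - u^-1 != 0 -> \det B = 1 -> \tr B = u + u^-1 ->
  \tr (A ^ z * B ^ w) =
    let tau := \tr (eigenproj t A * eigenproj u B) in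
    (t ^ z * u ^ w + t ^ (- z) * u ^ (- w)) * tau +
    (t ^ z * u ^ (- w) + t ^ (- z) * u ^ w) * (1 - tau).
Proof.
move=> t0 t1 dA tA u0 u1 dB tB.
rewrite (eigenproj_exprz t0 t1 dA tA) (eigenproj_exprz u0 u1 dB tB) /=.
have trE := eigenproj_trace t1 tA; have trF := eigenproj_trace u1 tB.
move: (eigenproj t A) (eigenproj u B) trE trF => E E' trE trF.
rewrite mulrDl !mulrDr -!scalerAl -!scalerAr !mulrBl !mulrBr !mul1r !mulr1.
have trN (M : 'M[F]_2) : \tr (- M) = - \tr M by rewrite raddfN.
rewrite !(mxtraceD, mxtraceZ, trN) trE trF mxtrace1; ring.
Qed.

Lemma mxtrace_eigenproj_conj A B t u P : P \is a GRing.unit ->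
  \tr (eigenproj t (P^-1 * A * P) * eigenproj u (P^-1 * B * P)) =
  \tr (eigenproj t A * eigenproj u B).
Proof.
move=> uP; have conjP v M : eigenproj v (P^-1 * M * P) = P^-1 * eigenproj v M * P.
  rewrite /eigenproj -scalerAr -scalerAl mulrBr mulrBl; congr (_ *: (_ - _)).
  by rewrite (scalar_mxC v^-1 P^-1 : P^-1 * _ = _ * P^-1) -mulrA mulVr // mulr1.
rewrite !conjP !mulrA (mulrK uP) -!mulrA.
rewrite (mxtrace_mulC P^-1 _ : \tr (P^-1 * _) = \tr (_ * P^-1)).
by rewrite mulrA (mulrK uP).
Qed.

Definition canonX t := mx2 t 0 0 t^-1.

(** The diagonal is forced by the trace and by the invariant tau relative to [canonX]. The upper
    right entry is normalized to 1, and determinant 1 then fixes the lower left one. *)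
Definition canonY u tau :=
  let a := u^-1 + tau * (u - u^-1) in let d := u - tau * (u - u^-1) in
  mx2 a 1 (a * d - 1) d.

Lemma canonX_det t : t != 0 -> \det (canonX t) = 1.
Proof. by move=> t0; rewrite det_mx2E !mxE /= mulfV // mulr0 subr0. Qed.

Lemma canonX_trace t : \tr (canonX t) = t + t^-1.
Proof. by rewrite mxtrace2E !mxE. Qed.

Lemma canonY_det u tau : \det (canonY u tau) = 1.
Proof. by rewrite det_mx2E !mxE /=; ring. Qed.

Lemma canonY_trace u tau : \tr (canonY u tau) = u + u^-1.
Proof. by rewrite mxtrace2E !mxE /=; ring. Qed.

Lemma eigenproj_canonX t : t - t^-1 != 0 -> eigenproj t (canonX t) = mx2 1 0 0 0.
Proof. by move=> t1; apply: eq_mx2; rewrite !mxE /= ?(mulVf, subrr, mulr0, subr0). Qed.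

Lemma canon_tau t u tau : t - t^-1 != 0 -> u - u^-1 != 0 ->
  \tr (eigenproj t (canonX t) * eigenproj u (canonY u tau)) = tau.
Proof.
move=> t1 u1; rewrite eigenproj_canonX // mxtrace2E -!mulmxE !mulmx2E !mxE /=.
rewrite !mul0r !addr0 mul1r mulr1n addrAC subrr add0r mulrC mulfK //.
Qed.

(** The projection of [canonX t] is diag(1, 0), so tau is the upper left entry of the projection of
    B; it determines B 0 0, the trace then gives B 1 1 and the determinant B 1 0. *)
Lemma canon_unique t u B : t - t^-1 != 0 -> u - u^-1 != 0 ->
  \det B = 1 -> \tr B = u + u^-1 -> B 0 1 = 1 ->
  B = canonY u (\tr (eigenproj t (canonX t) * eigenproj u B)).
Proof.
move=> t1 u1 dB tB B01; set tau := \tr _.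
have B00 : B 0 0 = u^-1 + tau * (u - u^-1).
  rewrite /tau eigenproj_canonX // mxtrace2E -!mulmxE !mulmx2E !mxE /=.
  by rewrite !mul0r !addr0 mul1r mulr1n mulrAC mulVf // mul1r [RHS]addrC subrK.
have B11 : B 1 1 = u - tau * (u - u^-1).
  by move: tB; rewrite mxtrace2E B00 => tB; rewrite -[LHS](addKr (u^-1 + tau * (u - u^-1))) tB; ring.
have B10 : B 1 0 = B 0 0 * B 1 1 - 1.
  by rewrite -dB det_mx2E B01; ring.
by apply: eq_mx2; rewrite ?B10 ?B01 ?B00 ?B11 !mxE.
Qed.

End Spectral.

(** * A basis adapted to a pair without common eigenvector *)

Section CanonicalForm.
Variable F : fieldType.
Implicit Types (A B : 'M[F]_2) (v w : 'cV[F]_2).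

Lemma mxcol2E v w : v = w <-> v 0 0 = w 0 0 /\ v 1 0 = w 1 0.
Proof.
split=> [-> //|[h0 h1]]; apply: (@mx2P F _ v w) => j; by rewrite ord1.
Qed.

Lemma collinear2 v w : v != 0 -> v 0 0 * w 1 0 = v 1 0 * w 0 0 -> exists k, w = k *: v.
Proof.
move=> v0 vw; have [v00|v00] := eqVneq (v 0 0) 0.
  have v10 : v 1 0 != 0.
    by apply: contra_neq v0 => v10; apply/mxcol2E; rewrite !mxE.
  exists (w 1 0 / v 1 0); apply/mxcol2E; rewrite !mxE v00 mulr0 divfK //; split=> //.
  by apply: (mulfI v10); rewrite -vw v00 mul0r mulr0.
exists (w 0 0 / v 0 0); apply/mxcol2E; rewrite !mxE divfK //; split=> //.
by apply: (mulfI v00); rewrite vw mulrC -mulrA mulrA mulrA; field.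
Qed.

(** If v and w were independent, both diagonal entries of A would be t^-1, and the trace would force
    t = t^-1. *)
Lemma eigenline2 A v w t : t - t^-1 != 0 -> \tr A = t + t^-1 -> v != 0 ->
  A *m v = t^-1 *: v -> A *m w = t^-1 *: w -> exists k, w = k *: v.
Proof.
move=> t1 tA v0 /mxcol2E + /mxcol2E; rewrite !mulmx2E !mxE => -[a1 a2] [b1 b2].
have [vw|vw] := eqVneq (v 0 0 * w 1 0) (v 1 0 * w 0 0); first exact: collinear2.
move: tA; rewrite mxtrace2E => tA; exfalso; move: vw; rewrite -subr_eq0 => vw.
(* Eliminating the off-diagonal entry from the two eigenvector equations, as in Cramer's rule,
   leaves the determinant of (v, w) as a factor. *)
have e1 : (A 0 0 - t^-1) * (v 0 0 * w 1 0 - v 1 0 * w 0 0) = 0.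
  transitivity (w 1 0 * (A 0 0 * v 0 0 + A 0 1 * v 1 0 - t^-1 * v 0 0) -
    v 1 0 * (A 0 0 * w 0 0 + A 0 1 * w 1 0 - t^-1 * w 0 0)); first by ring.
  by rewrite a1 b1 !subrr !mulr0 subrr.
have e2 : (A 1 1 - t^-1) * (v 0 0 * w 1 0 - v 1 0 * w 0 0) = 0.
  transitivity (v 0 0 * (A 1 0 * w 0 0 + A 1 1 * w 1 0 - t^-1 * w 1 0) -
    w 0 0 * (A 1 0 * v 0 0 + A 1 1 * v 1 0 - t^-1 * v 1 0)); first by ring.
  by rewrite a2 b2 !subrr !mulr0 subrr.
have : (t - t^-1) * (v 0 0 * w 1 0 - v 1 0 * w 0 0) = 0.
  rewrite -[RHS](addr0 0) -{1}e1 -e2 -mulrDl; congr (_ * _).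
  by rewrite addrACA tA; ring.
by move/eqP; rewrite mulf_eq0 (negPf t1) (negPf vw).
Qed.

(** The basis is (e, f), with f an eigenvector of A for t^-1 and e the component of B f in the
    t-eigenspace. Then A becomes diagonal, and B f is e plus a multiple of f, which gives the entry
    1. *)
Lemma canonical_basis A B t : t != 0 -> t - t^-1 != 0 ->
  \det A = 1 -> \tr A = t + t^-1 ->
  (forall v a b, v != 0 -> A *m v = a *: v -> B *m v = b *: v -> False) ->
  exists P : 'M[F]_2, [/\ \det P != 0, A * P = P * canonX t &
    forall B', B * P = P * B' -> B' 0 1 = 1].
Proof.
move=> t0 t1 dA tA irr.
have [|f f0 Af] := @det0_ker F _ (A - t^-1%:M).
  have tt : t * t^-1 = 1 by rewrite mulfV.
  move: dA tA; rewrite !det_mx2E mxtrace2E !mxE /= !mulr1n !subr0 => dA tA.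
  transitivity ((A 0 0 * A 1 1 - A 0 1 * A 1 0) - t^-1 * (A 0 0 + A 1 1)
    + t^-1 ^+ 2); first by ring.
  by rewrite dA tA mulrDr mulVf // -expr2; ring.
have {}Af : A *m f = t^-1 *: f.
  by move/eqP: Af; rewrite mulmxBl subr_eq0 mul_scalar_mx => /eqP.
set E := eigenproj t A; pose e := E *m (B *m f).
have Ee : E *m e = e by rewrite mulmxA mulmxE eigenproj_idem.
have eE : E *m (B *m f) = e by [].
clearbody e.
have EA : A *m E = t *: E.
  transitivity ((t *: E + t^-1 *: (1 - E)) * E); first by rewrite -eigenprojE.
  have := eigenproj_idem t0 t1 dA tA; rewrite -/E; move: (E) => M MM.
  by rewrite mulrDl -!scalerAl mulrBl mul1r MM subrr scaler0 addr0.
have Ae : A *m e = t *: e by rewrite -{1}Ee mulmxA EA -scalemxAl Ee.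
have EE w : E *m w = (t - t^-1)^-1 *: (A *m w - t^-1 *: w).
  by rewrite -scalemxAl mulmxBl mul_scalar_mx.
(* If e were zero, B f would lie in the t^-1-eigenspace, which is the line of f, and f would be a
   common eigenvector. *)
have e0 : e != 0.
  apply/eqP => e0; have : A *m (B *m f) = t^-1 *: (B *m f).
    move: e0; rewrite -eE EE => /eqP; rewrite scaler_eq0 invr_eq0 (negPf t1) /=.
    by rewrite subr_eq0 => /eqP.
  by move=> /(eigenline2 t1 tA f0 Af)[k Bf]; apply: (irr f t^-1 k).
have ef : e 0 0 * f 1 0 - e 1 0 * f 0 0 != 0.
  rewrite subr_eq0; apply/eqP => /(collinear2 e0)[k fk].
  have : (t - t^-1) *: f = 0.
    by rewrite scalerBl -Af {1 2}fk -scalemxAr Ae !scalerA mulrC subrr.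
  by move/eqP; rewrite scaler_eq0 (negPf t1) (negPf f0).
pose P := mx2 (e 0 0) (f 0 0) (e 1 0) (f 1 0).
exists P; split.
- by rewrite det_mx2E !mxE /= [f 0 0 * _]mulrC.
- move/mxcol2E: Ae; move/mxcol2E: Af; rewrite !mulmx2E !mxE => -[f1 f2] [e1 e2].
  by apply: eq_mx2; rewrite -!mulmxE !mulmx2E !mxE /= ?mulr0 ?addr0 ?add0r ?f1 ?f2 ?e1 ?e2 mulrC.
move=> B' BP.
have Bf : B *m f = B' 0 1 *: e + B' 1 1 *: f.
  apply/mxcol2E; rewrite !mulmx2E !mxE.
  have /matrixP BP' : B *m P = P *m B' by [].
  have := BP' 0 1; have := BP' 1 1; rewrite !mulmx2E !mxE /= => -> ->.
  by rewrite ![B' _ _ * _]mulrC.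
(* As E fixes e and kills f, applying it to B f isolates the coefficient of e. *)
have : E *m (B *m f) = B' 0 1 *: e.
  by rewrite Bf mulmxDr -!scalemxAr Ee EE Af subrr !scaler0 addr0.
rewrite eE => /eqP; rewrite -subr_eq0 -{1}[e]scale1r -scalerBl scaler_eq0 (negPf e0) orbF.
by rewrite subr_eq0 => /eqP.
Qed.

End CanonicalForm.

(** * Irreducible representations *)

Section MakeRep.
Variables (R : realType) (p q : nat).
Local Notation C := R[i].
Local Notation G := (torus_group p q).
Variables X Y : 'M[C]_2.

Definition letter_mx (l : bool * bool) : 'M[C]_2 :=
  let M := if l.1 then X else Y in if l.2 then M^-1 else M.

Definition word_mx (w : word bool) : 'M[C]_2 := foldr (fun l M => letter_mx l * M) 1 w.

Definition matrix_rep (g : G) : 'M[C]_2 := word_mx (repr g).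

Lemma word_mx_cat u v : word_mx (u ++ v) = word_mx u * word_mx v.
Proof. by elim: u => [|l u IHu] /=; rewrite ?mul1r // IHu mulrA. Qed.

Hypotheses (dX : \det X = 1) (dY : \det Y = 1) (XY : X ^+ p = Y ^+ q).

(** This makes [matrix_rep], which evaluates a chosen representative word, independent of that
    choice and hence multiplicative. *)
Lemma word_mx_equiv u v : word_equiv (torus_relation p q) u v -> word_mx u = word_mx v.
Proof.
elim=> {u v} [//|u v _ -> //|u v w _ -> _ -> //|u u' v v' _ IHu _ IHv|x e|u v [] /=].
- by rewrite !word_mx_cat IHu IHv.
- have uX := SL2_unit dX; have uY := SL2_unit dY.
  by case: x e => -[]; rewrite /word_mx /letter_mx /= mulr1 ?mulrV ?mulVr.
- have nE l n : word_mx (nseq n l) = letter_mx l ^+ n.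
    by elim: n => //= n ->; rewrite exprS.
  by rewrite !nE.
Qed.

Lemma matrix_rep_pclass w : matrix_rep (pclass _ w) = word_mx w.
Proof. exact/word_mx_equiv/word_equiv_repr. Qed.

Lemma matrix_rep_x : matrix_rep (tx p q) = X.
Proof. by rewrite matrix_rep_pclass /= mulr1. Qed.

Lemma matrix_rep_y : matrix_rep (ty p q) = Y.
Proof. by rewrite matrix_rep_pclass /= mulr1. Qed.

Lemma matrix_rep_SL2 : is_SL2_rep matrix_rep.
Proof.
split=> [|g h|g]; first exact: (matrix_rep_pclass [::]).
  by rewrite mulmxE -word_mx_cat -(matrix_rep_pclass (repr g ++ repr h)).
rewrite /matrix_rep; elim: (repr g) => [|[x e] w IHw] /=; first exact: det1.
rewrite -mulmxE det_mulmx IHw mulr1 /letter_mx.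
by case: x e => -[] //=; rewrite det_inv ?dX ?dY invr1.
Qed.

End MakeRep.

(** * Irreducibility criterion and eigenvalues of the generators *)

Section Classification.
Variables (R : realType) (p q : nat).
Local Notation C := R[i].
Local Notation G := (torus_group p q).
Local Notation rep := (G -> 'M[C]_2).
Local Notation x := (tx p q).
Local Notation y := (ty p q).
Implicit Types rho : rep.

(** An invariant line would be spanned by an eigenvector of [canonX t], that is, by a coordinate
    vector; neither axis is invariant under [canonY u tau], whose off-diagonal entries are both
    nonzero. *)
Lemma rep_irreducible rho t u tau : is_SL2_rep rho ->
  t - t^-1 != 0 -> u - u^-1 != 0 -> tau != 0 -> tau != 1 ->
  rho x = canonX t -> rho y = canonY u tau -> irreducible_rep rho.
Proof.
move=> hr t1 u1 tau0 tau1 hx hy U inv.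
(* The lower left entry is tau (1 - tau) (u - u^-1)^2. *)
have w0 : canonY u tau 1 0 != 0.
  rewrite !mxE /= (_ : _ - 1 = (tau * (1 - tau)) * (u - u^-1) ^+ 2 + (u^-1 * u - 1)); last by ring.
  have u0 : u != 0 by apply: contra_neq u1 => ->; rewrite invr0 subrr.
  rewrite mulVf // subrr addr0; apply: mulf_neq0; last exact: expf_neq0.
  by rewrite mulf_neq0 // subr_eq0 eq_sym.
have [U0|] := eqVneq (\dim U) 0%N; first by left; apply/eqP; rewrite -dimv_eq0 U0.
have dimC : \dim {: 'cV[C]_2} = 2%N by rewrite dimvf.
have [U2 _|U2] := eqVneq (\dim U) 2%N.
  by right; apply/eqP; rewrite eqEdim subvf dimC U2.
have := dimvS (subvf U); rewrite dimC => Ule U0.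
have U1 : \dim U = 1%N by move: (\dim U) U0 U2 Ule => [|[|[|]]].
have vU : vpick U \in U by exact: memv_pick.
have v0 : vpick U != 0 by rewrite vpick0 -dimv_eq0 U1.
have lineU : U = <[vpick U]>%VS.
  by apply/esym/eqP; rewrite eqEdim -memvE vU U1 dim_vline v0.
move: (vpick U) vU v0 lineU => v vU v0 lineU.
have := inv x _ vU; have := inv y _ vU; rewrite lineU => /vlineP[b yv] /vlineP[a xv].
move: yv xv; rewrite hx hy => /mxcol2E + /mxcol2E; rewrite !mulmx2E.
move: w0; rewrite [canonX t 0 0]mxE [canonX t 0 1]mxE [canonX t 1 0]mxE [canonX t 1 1]mxE /=.
rewrite [canonY u tau 0 1]mxE /=.
move: (canonY u tau 1 0) (canonY u tau 1 1) (canonY u tau 0 0) => w d f w0.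
rewrite ![(_ *: v) _ _]mxE => -[y0 y1] [x0 x1].
have [v00|v00] := eqVneq (v 0 0) 0.
  have v10 : v 1 0 = 0 by move: y0; rewrite v00 !mulr0 mul1r add0r.
  by move/eqP: v0; case; apply/mxcol2E; rewrite !mxE.
have [v10|v10] := eqVneq (v 1 0) 0.
  move/eqP: y1; rewrite v10 !mulr0 addr0 mulf_eq0 (negPf w0) (negPf v00) //.
move: x0 x1; rewrite !mul0r addr0 add0r => /(mulIf v00) ta /(mulIf v10) ta'.
by rewrite -ta in ta'; move: t1; rewrite ta' subrr eqxx.
Qed.

Lemma rep_conj_canon rho t u : is_SL2_rep rho -> irreducible_rep rho ->
  t - t^-1 != 0 -> u - u^-1 != 0 -> \tr (rho x) = t + t^-1 -> \tr (rho y) = u + u^-1 ->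
  exists P, [/\ \det P = 1, rho x = P * canonX t * P^-1 &
    rho y = P * canonY u (\tr (eigenproj t (rho x) * eigenproj u (rho y))) * P^-1].
Proof.
move=> hr irr t1 u1 trx try_; have [r1 rM rd] := hr.
have t0 : t != 0 by apply: contra_neq t1 => ->; rewrite invr0 subrr.
have [|P [P0 PX PY]] := @canonical_basis _ (rho x) (rho y) t t0 t1 (rd x) trx.
  by move=> v a b v0 xv yv; exact: (reducible_eigenvector hr v0 xv yv).
(* Dividing the basis matrix by a square root of its determinant puts it in SL_2 without changing
   the conjugated matrices. *)
pose k : C := (sqrtc (\det P))^-1; pose Q := k *: P.
have k2 : k ^+ 2 = (\det P)^-1 by rewrite exprVn sqr_sqrtc.
have k0 : k != 0 by rewrite invr_eq0 sqrtc_eq0.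
have dQ : \det Q = 1 by rewrite detZ k2 mulVf.
have uQ := SL2_unit dQ.
have hx : rho x = Q * canonX t * Q^-1.
  by apply: (mulIr uQ); rewrite mulrVK // -scalerAr PX -scalerAl.
pose B := Q^-1 * rho y * Q.
have hB : rho y = Q * B * Q^-1 by rewrite /B !mulrA mulrV // mul1r mulrK.
have B01 : B 0 1 = 1.
  apply: PY; rewrite -[LHS]scale1r -(mulVf k0).
  rewrite -scalerA scalerAr -/Q (_ : rho y * Q = Q * B); last by rewrite hB mulrVK.
  rewrite /Q -scalerAl scalerA mulVf ?scale1r //.
have dB : \det B = 1 by rewrite /B -!mulmxE !det_mulmx det_inv dQ rd invr1 !mulr1.
have tB : \tr B = u + u^-1.
  rewrite -try_ hB; rewrite (mxtrace_mulC (Q * B) Q^-1 : \tr (Q * B * Q^-1) = \tr (Q^-1 * (Q * B))).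
  by rewrite mulrA mulVr // mul1r.
have projE : \tr (eigenproj t (canonX t) * eigenproj u B) =
    \tr (eigenproj t (rho x) * eigenproj u (rho y)).
  have hx' : Q^-1 * rho x * Q = canonX t by rewrite hx !mulrA mulVr // mul1r mulrVK.
  have := mxtrace_eigenproj_conj (rho x) (rho y) t u uQ.
  by rewrite hx'.
exists Q; split; [exact: dQ | exact: hx |].
by rewrite -projE -(canon_unique t1 u1 dB tB B01); exact: hB.
Qed.

Lemma scalar_not_irreducible_x rho c : is_SL2_rep rho -> irreducible_rep rho ->
  rho x = c%:M -> False.
Proof.
move=> hr irr hx; have [b db] := exists_eigenvalue2 (rho y).
have [v v0] := det0_ker db; rewrite mulmxBl mul_scalar_mx => /eqP; rewrite subr_eq0 => /eqP yv.
by apply: (reducible_eigenvector (a := c) hr v0 _ yv irr); rewrite hx mul_scalar_mx.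
Qed.

Lemma scalar_not_irreducible_y rho c : is_SL2_rep rho -> irreducible_rep rho ->
  rho y = c%:M -> False.
Proof.
move=> hr irr hy; have [b db] := exists_eigenvalue2 (rho x).
have [v v0] := det0_ker db; rewrite mulmxBl mul_scalar_mx => /eqP; rewrite subr_eq0 => /eqP xv.
by apply: (reducible_eigenvector (b := c) hr v0 xv _ irr); rewrite hy mul_scalar_mx.
Qed.

(** With eigenvalues t and t^-1 distinct, t^n = c makes t a 2n-th root of unity other than 1 and -1.
    A double eigenvalue is impossible: A would be a scalar plus a nilpotent N, and a scalar power of
    A makes N scalar in characteristic 0. *)
Lemma scalar_power_trace n (A : 'M[C]_2) c : (0 < n)%N -> \det A = 1 ->
  A ^+ n = c%:M -> c ^+ 2 = 1 -> (forall d, A <> d%:M) ->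
  exists2 k, (0 < k < n)%N & \tr A = (2 * cos (pi * k%:R / n%:R))%:C%C /\ c = (-1) ^+ k.
Proof.
move=> n0 dA An c2 nA; have [t dt] := exists_eigenvalue2 A.
have char : t ^+ 2 - \tr A * t + 1 = 0.
  rewrite -dt -[X in _ + X]dA !det_mx2E mxtrace2E !mxE /= !mulr1n !subr0; ring.
have t0 : t != 0.
  by apply: contra_eq_neq char => ->; rewrite expr0n mulr0 subrr add0r oner_neq0.
have trA : \tr A = t + t^-1.
  apply: (mulIf t0); rewrite mulrDl mulVf // -expr2.
  by apply/eqP; rewrite eq_sym -subr_eq0 addrAC char.
have [tt|t1] := eqVneq (t - t^-1) 0.
  exfalso; have tV : t^-1 = t by move/eqP: tt; rewrite subr_eq0 => /eqP.
  have t2 : t * t = 1 by rewrite -{2}tV mulfV.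
  pose N : 'M[C]_2 := A - t%:M; have AN : A = t%:M + N by rewrite addrC subrK.
  have NN : N * N = 0.
    rewrite /N -mulmxE mulmxBl !mulmxBr Cayley_Hamilton2 dA trA tV.
    rewrite mul_scalar_mx mul_mx_scalar mul_scalar_mx scale_scalar_mx t2 scalerDl.
    by apply/matrixP => i j; rewrite !mxE; ring.
  clearbody N.
  have powN m : A ^+ m.+1 = (t ^+ m.+1)%:M + (m.+1%:R * t ^+ m) *: N.
    elim: m => [|m IHm]; first by rewrite expr0 mulr1 !expr1 scale1r.
    rewrite exprS IHm AN mulrDl !mulrDr -!scalerAr NN scaler0 addr0.
    rewrite -!mulmxE -scalar_mxM mul_scalar_mx mul_mx_scalar scalerA -exprS -addrA -scalerDl.
    by congr (_ + _ *: _); rewrite -[m.+2%:R]natr1 [RHS]mulrDl mul1r exprSr mulrA.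
  case: n n0 An => // m _; rewrite powN => An.
  have k0 : m.+1%:R * t ^+ m != 0 :> C by rewrite mulf_neq0 ?pnatr_eq0 ?expf_neq0.
  (* The scalar comes from solving c = t^n + n t^(n-1) N for N, with n = m + 1. *)
  apply: (nA (t + (m.+1%:R * t ^+ m)^-1 * (c - t ^+ m.+1))).
  rewrite {1}AN raddfD /= -scale_scalar_mx; congr (_ + _).
  by rewrite raddfB /= -An addrC addKr scalerA mulVf // scale1r.
have E0 := eigenproj_trace t1 trA; have EE := eigenproj_idem t0 t1 dA trA.
(* Multiplying by the idempotent of trace 1 and taking traces reads off the eigenvalue. *)
have tn : t ^+ n = c.
  have := congr1 (mulmx (eigenproj t A)) An; rewrite exprnP (eigenproj_exprz t0 t1 dA trA).
  move: (eigenproj t A) E0 EE => E E0 EE.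
  rewrite mul_mx_scalar mulmxE mulrDr -!scalerAr mulrBr mulr1 EE subrr scaler0 addr0.
  by move=> /(congr1 mxtrace); rewrite !mxtraceZ E0 !mulr1.
have t2n : t ^+ (2 * n) = 1 by rewrite mulnC exprM tn.
have t_neq1 : t <> 1 by move=> tE; move: t1; rewrite tE invr1 subrr eqxx.
have t_neqN1 : t <> -1 by move=> tE; move: t1; rewrite tE invrN1 subrr eqxx.
have [k kn tk] := expi_root n0 t2n t_neq1 t_neqN1.
exists k => //; rewrite expi_cos trA -tn.
have en : expi (pi * k%:R / n%:R : R) ^+ n = (-1) ^+ k.
  by rewrite expi_frac -exprM mulnC exprM expi_fracn.
case: tk => ->; first by rewrite expiN.
by rewrite -expiN opprK addrC expiN exprVn en -exprVn invrN1.
Qed.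

Lemma irrep_component rho : (0 < p)%N -> (0 < q)%N -> irrep rho ->
  exists a b, [/\ component_index p q a b,
    \tr (rho x) = (2 * cos (pi * a%:R / p%:R))%:C%C &
    \tr (rho y) = (2 * cos (pi * b%:R / q%:R))%:C%C].
Proof.
move=> p0 q0 [hr irr]; have [r1 rM rd] := hr; have rel := SL2_rep_relation hr.
have [||c xp] := irreducible_central (Z := rho x ^+ p) hr irr.
- exact/esym/commrX.
- by rewrite rel; exact/esym/commrX.
have c2 : c ^+ 2 = 1.
  by rewrite -det_scalar -xp -SL2_repX // rd.
have [a ap [tra ca]] := scalar_power_trace p0 (rd x) xp c2 (fun d => @scalar_not_irreducible_x _ d hr irr).
have [b bq [trb cb]] := scalar_power_trace q0 (rd y) (etrans (esym rel) xp) c2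
  (fun d => @scalar_not_irreducible_y _ d hr irr).
exists a, b; split=> //; split=> //.
have : (-1) ^+ a = (-1) ^+ b :> C by rewrite -ca -cb.
rewrite -signr_odd -[RHS]signr_odd => /eqP; rewrite (inj_eq (@signr_inj _)) => /eqP ab.
by rewrite !modn2 ab.
Qed.

End Classification.

(** * Classes with a given trace of the meridian *)

(** By the Bezout relation, 2 is a combination of 2m and 2n, so t^2 = 1. *)
Lemma coprime_roots_of_unity (F : fieldType) (t : F) (m n i j : int) : t != 0 ->
  t ^ (2 * m) = 1 -> t ^ (2 * n) = 1 -> m * i + n * j = 1 -> t - t^-1 = 0.
Proof.
move=> t0 tm tn mn; have t2 : t ^ (2 : int) = 1.
  rewrite (_ : (2 : int) = 2 * m * i + 2 * n * j); last by rewrite -!mulrA -mulrDr mn mulr1.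
  rewrite expfzDr // -(exprz_exp t (2 * m) i) -(exprz_exp t (2 * n) j) tm tn.
  by rewrite !exp1rz mulr1.
by apply: (mulfI t0); rewrite mulr0 mulrBr mulfV // -(t2 : t * t = 1) subrr.
Qed.

Lemma expz_sub_neq0 (F : fieldType) (t : F) (m n i j : int) : t != 0 -> t - t^-1 != 0 ->
  t ^ (2 * m) = 1 -> m * i + n * j = 1 -> t ^ n - t ^ (- n) != 0.
Proof.
move=> t0 t1 tm mn; apply: contra_neq t1 => tn.
apply: (coprime_roots_of_unity t0 tm _ mn).
rewrite mulrDl mul1r expfzDr //; move/eqP: tn; rewrite subr_eq0 => /eqP {1}->.
by rewrite -expfzDr // addNr.
Qed.

Section Parametrization.
Variables (R : realType) (p q : nat).
Local Notation C := R[i].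
Hypotheses (p_ge2 : (2 <= p)%N) (q_ge2 : (2 <= q)%N).
Local Notation x := (tx p q).
Local Notation y := (ty p q).
Local Notation xi := (frac_expi R p).
Local Notation eta := (frac_expi R q).

(** This is the coefficient of tau in the trace of the meridian; replacing s by -s gives the
    coefficient of 1 - tau. *)
Definition meridian_coef (r s : int) (t u : C) := t ^ (- r) * u ^ s + t ^ r * u ^ (- s).

Lemma meridian_coefE r s a b : meridian_coef r s (xi a) (eta b) =
  (2 * cos (pi * (r%:~R * a%:R / p%:R - s%:~R * b%:R / q%:R)))%:C%C.
Proof.
rewrite expi_cos /meridian_coef addrC -!expi_int -!expiD !mulrNz.
by congr (expi _ + expi _); ring.
Qed.

(** Up to sign the difference is (t^r - t^-r)(u^s - u^-s) with t^(2p) = u^(2q) = 1. Neither factor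
    vanishes, since ps - qr = 1 makes r prime to p and s prime to q. *)
Lemma meridian_coef_neq r s a b : p%:Z * s - q%:Z * r = 1 -> component_index p q a b ->
  meridian_coef r s (xi a) (eta b) - meridian_coef r (- s) (xi a) (eta b) != 0.
Proof.
move=> rs_eq [ha hb _].
have -> : meridian_coef r s (xi a) (eta b) - meridian_coef r (- s) (xi a) (eta b) =
    - ((xi a ^ r - xi a ^ (- r)) * (eta b ^ s - eta b ^ (- s))).
  by rewrite /meridian_coef opprK; ring.
rewrite oppr_eq0 mulf_neq0 //.
- apply: (@expz_sub_neq0 _ _ p%:Z r s (- q%:Z)).
  + exact: frac_expi_neq0.
  + exact: frac_expi_subV.
  + by rewrite -(PoszM 2) -exprnP frac_expi_expr2n //; lia.
  + by rewrite -rs_eq; ring.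
- apply: (@expz_sub_neq0 _ _ q%:Z s (- r) p%:Z).
  + exact: frac_expi_neq0.
  + exact: frac_expi_subV.
  + by rewrite -(PoszM 2) -exprnP frac_expi_expr2n //; lia.
  + by rewrite -rs_eq; ring.
Qed.

Lemma frac_expi_power n k (A : 'M[C]_2) : (0 < k < n)%N -> \det A = 1 ->
  \tr A = frac_expi R n k + (frac_expi R n k)^-1 -> A ^+ n = ((-1) ^+ k)%:M.
Proof.
move=> kn dA tA; have t0 := frac_expi_neq0 R n k; have t1 := frac_expi_subV R kn.
have n0 : (0 < n)%N by lia.
rewrite exprnP (eigenproj_exprz t0 t1 dA tA) -exprnP -exprnN frac_expi_exprn //.
by rewrite -signr_odd; case: odd; rewrite ?invrN1 ?invr1 -scalerDr addrC subrK scalemx1.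
Qed.

Variables (r s : int) (c : C).
Hypothesis rs_eq : p%:Z * s - q%:Z * r = 1.
Hypothesis c_neq : forall a b : nat, component_index p q a b ->
  c <> (2 * cos (pi * (r%:~R * a%:R / p%:R + s%:~R * b%:R / q%:R)))%:C%C /\
  c <> (2 * cos (pi * (r%:~R * a%:R / p%:R - s%:~R * b%:R / q%:R)))%:C%C.
Local Notation mu := (meridian p q r s).

(** The solution tau of the affine equation saying that the meridian has trace c. *)
Definition meridian_tau a b : C :=
  (c - meridian_coef r (- s) (xi a) (eta b)) /
  (meridian_coef r s (xi a) (eta b) - meridian_coef r (- s) (xi a) (eta b)).

Lemma meridian_traceE (rho : torus_group p q -> 'M[C]_2) a b :
  is_SL2_rep rho -> component_index p q a b ->
  \tr (rho x) = xi a + (xi a)^-1 -> \tr (rho y) = eta b + (eta b)^-1 ->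
  \tr (rho mu) = c <->
  \tr (eigenproj (xi a) (rho x) * eigenproj (eta b) (rho y)) = meridian_tau a b.
Proof.
move=> hr hab trx try_; have [r1 rM rd] := hr.
have neq := meridian_coef_neq rs_eq hab.
have [ha hb _] := hab.
rewrite SL2_rep_meridian // (mxtrace_eigenproj_mul _ _ (frac_expi_neq0 R p a)
  (frac_expi_subV R ha) (rd x) trx (frac_expi_neq0 R q b) (frac_expi_subV R hb) (rd y) try_) /=.
move: (\tr (eigenproj _ _ * _)) => tau.
rewrite /meridian_tau opprK -/(meridian_coef r s (xi a) (eta b)).
have -> : xi a ^ (- r) * eta b ^ (- s) + xi a ^ r * eta b ^ s = meridian_coef r (- s) (xi a) (eta b).
  by rewrite /meridian_coef opprK.
move: (meridian_coef r s (xi a) (eta b)) (meridian_coef r (- s) (xi a) (eta b)) neq => c1 c2 neq.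
split=> [<-|->]; last by field.
by apply: (mulIf neq); rewrite divfK //; ring.
Qed.

(** The values 0 and 1 of tau would make c one of the two coefficients, which are exactly the
    excluded cosines. *)
Lemma meridian_tau_neq a b : component_index p q a b ->
  meridian_tau a b != 0 /\ meridian_tau a b != 1.
Proof.
move=> hab; have neq := meridian_coef_neq rs_eq hab; have [] := c_neq hab.
have -> : r%:~R * a%:R / p%:R + s%:~R * b%:R / q%:R =
    r%:~R * a%:R / p%:R - (- s)%:~R * b%:R / q%:R :> R by rewrite mulrNz; ring.
rewrite -!meridian_coefE => h2 h1.
rewrite /meridian_tau; move: (meridian_coef r s (xi a) (eta b)) (meridian_coef r (- s) (xi a) (eta b)) neq h1 h2.
move=> c1 c2 neq h1 h2; split.
  by rewrite mulf_neq0 ?invr_eq0 // subr_eq0; apply/eqP.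
apply/eqP => /(congr1 (fun z => z * (c1 - c2))); rewrite divfK // mul1r.
by move=> /(addIr _).
Qed.

Definition canonical_rep a b : torus_group p q -> 'M[C]_2 :=
  @matrix_rep R p q (canonX (xi a)) (canonY (eta b) (meridian_tau a b)).

Section Canonical.
Variables (a b : nat).
Hypothesis hab : component_index p q a b.

Let dX : \det (canonX (xi a)) = 1. Proof. exact/canonX_det/frac_expi_neq0. Qed.
Let dY : \det (canonY (eta b) (meridian_tau a b)) = 1. Proof. exact: canonY_det. Qed.
Let XY : canonX (xi a) ^+ p = canonY (eta b) (meridian_tau a b) ^+ q.
Proof.
have [ha hb ab] := hab.
rewrite (frac_expi_power ha dX) ?canonX_trace // (frac_expi_power hb dY) ?canonY_trace //.
by rewrite -signr_odd -[in RHS]signr_odd; move: ab; rewrite !modn2; do 2!case: odd.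
Qed.

Lemma canonical_rep_x : canonical_rep a b x = canonX (xi a).
Proof. exact: matrix_rep_x dX dY XY. Qed.

Lemma canonical_rep_y : canonical_rep a b y = canonY (eta b) (meridian_tau a b).
Proof. exact: matrix_rep_y dX dY XY. Qed.

Lemma canonical_rep_SL2 : is_SL2_rep (canonical_rep a b).
Proof. exact: matrix_rep_SL2 dX dY XY. Qed.

Lemma canonical_rep_irrep : irrep (canonical_rep a b).
Proof.
have [ha hb _] := hab; have [t0 t1] := meridian_tau_neq hab.
split; first exact: canonical_rep_SL2.
exact: (rep_irreducible canonical_rep_SL2 (frac_expi_subV R ha) (frac_expi_subV R hb) t0 t1
  canonical_rep_x canonical_rep_y).
Qed.

Lemma canonical_rep_trace_x : \tr (canonical_rep a b x) = xi a + (xi a)^-1.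
Proof. by rewrite canonical_rep_x canonX_trace. Qed.

Lemma canonical_rep_trace_y : \tr (canonical_rep a b y) = eta b + (eta b)^-1.
Proof. by rewrite canonical_rep_y canonY_trace. Qed.

Lemma canonical_rep_trace_meridian : \tr (canonical_rep a b mu) = c.
Proof.
have [ha hb _] := hab.
apply/(meridian_traceE canonical_rep_SL2 hab canonical_rep_trace_x canonical_rep_trace_y).
by rewrite canonical_rep_x canonical_rep_y canon_tau // ?frac_expi_subV.
Qed.

Lemma conj_canonical_rep rho : irrep rho ->
  \tr (rho x) = xi a + (xi a)^-1 -> \tr (rho y) = eta b + (eta b)^-1 ->
  \tr (rho mu) = c -> conj_class rho = conj_class (canonical_rep a b).
Proof.
move=> [hr irr] trx try_ /(meridian_traceE hr hab trx try_) tauE; have [ha hb _] := hab.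
have [P [dP xP yP]] := rep_conj_canon hr irr (frac_expi_subV R ha) (frac_expi_subV R hb) trx try_.
apply/esym/conj_class_eq; exists P; split; first exact: dP.
apply: (conj_class_gen canonical_rep_SL2 hr dP).
  by rewrite canonical_rep_x; exact: xP.
by rewrite canonical_rep_y -tauE; exact: yP.
Qed.

End Canonical.

Definition index_pairs : seq (nat * nat) :=
  [seq ab <- [seq (a, b) | a <- index_iota 1 p, b <- index_iota 1 q] | odd ab.1 == odd ab.2].

Lemma index_pairsP a b : (a, b) \in index_pairs <-> component_index p q a b.
Proof.
rewrite mem_filter /=; split.
  case/andP => /eqP ab /allpairsPdep[a' [b' []]]; rewrite !mem_index_iota => ha hb [aE bE].
  by subst a' b'; split=> //; rewrite !modn2 ab.
move=> [ha hb ab]; apply/andP; split.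
  by move: ab; rewrite !modn2; do 2!case: odd.
by apply/allpairsPdep; exists a, b; rewrite !mem_index_iota.
Qed.

Lemma index_pairs_uniq : uniq index_pairs.
Proof.
by rewrite filter_uniq // allpairs_uniq ?iota_uniq // => -[? ?] [? ?] _ _ /=.
Qed.

Definition canonical_class (ab : nat * nat) : set (torus_group p q -> 'M[C]_2) :=
  conj_class (canonical_rep ab.1 ab.2).

Lemma component_unique (K : set (torus_group p q -> 'M[C]_2)) a b a' b' :
  component_index p q a b -> component_index p q a' b' ->
  component a b K -> component a' b' K -> a = a' /\ b = b'.
Proof.
move=> [ha hb _] [ha' hb' _] [[rho0 _ <-]].
move=> [rho1 K1 [x1 y1]] [_ [rho2 K2 [x2 y2]]].
have trE g : \tr (rho1 g) = \tr (rho2 g).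
  by rewrite (conj_class_trace g K1) (conj_class_trace g K2).
have cosE n k l : (0 < k < n)%N -> (0 < l < n)%N ->
    (2 * cos (pi * k%:R / n%:R : R))%:C%C = (2 * cos (pi * l%:R / n%:R : R))%:C%C -> k = l.
  move=> hk hl /complexI /(mulfI _) E; apply: (cos_frac_inj hk hl (E _)).
  by rewrite pnatr_eq0.
by split; [apply: (cosE p) | apply: (cosE q)] => //; rewrite -?x1 -?y1 trE.
Qed.

Lemma canonical_class_component a b : component_index p q a b ->
  component a b (canonical_class (a, b)).
Proof.
move=> hab; split; first by exists (canonical_rep a b) => //; exact: canonical_rep_irrep.
exists (canonical_rep a b); first exact: conj_class_refl.
by rewrite canonical_rep_trace_x // canonical_rep_trace_y // !frac_expi_cos.
Qed.

Lemma index_of_canonical_class a b : component_index p q a b ->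
  index_of (canonical_class (a, b)) = (a, b).
Proof.
move=> hab; rewrite /index_of; case: xgetP => [[a' b'] _ /= [hab' K']|/(_ (a, b))/=[]].
  by have [-> ->] := component_unique hab hab' (canonical_class_component hab) K'.
by split=> //; exact: canonical_class_component.
Qed.

(** Every irreducible class lies over some (a, b) by [irrep_component], and the trace c fixes tau,
    hence the class by [conj_canonical_rep]. *)
Lemma irrep_classes_traceE :
  irrep_classes_trace mu c = canonical_class @` [set` index_pairs].
Proof.
apply/seteqP; split=> [K [[rho0 irr0 <-]] [rho K1 muc]|K [[a b]]].
  have [a [b [hab trx try_]]] := irrep_component (ltnW p_ge2) (ltnW q_ge2) irr0.
  exists (a, b); first exact/index_pairsP.
  rewrite /canonical_class /= -(conj_canonical_rep hab irr0) ?trx ?try_ ?frac_expi_cos //.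
  by rewrite -(conj_class_trace mu K1).
move=> /= /index_pairsP hab <-; split.
  by exists (canonical_rep a b) => //; exact: canonical_rep_irrep.
exists (canonical_rep a b); first exact: conj_class_refl.
exact: canonical_rep_trace_meridian.
Qed.

Lemma canonical_class_inj : set_inj [set` index_pairs] canonical_class.
Proof.
move=> [a b] [a' b'] /set_mem/= /index_pairsP hab /set_mem/= /index_pairsP hab' E.
by rewrite -(index_of_canonical_class hab) E index_of_canonical_class.
Qed.

Lemma sum_irrep_classes_trace (f : nat * nat -> C) :
  \sum_(K \in irrep_classes_trace mu c) f (index_of K) =
  \sum_(1 <= a < p) \sum_(1 <= b < q | odd a == odd b) f (a, b).
Proof.
rewrite irrep_classes_traceE fsbig_image; last exact: canonical_class_inj.
rewrite -fsbig_seq ?index_pairs_uniq // big_filter big_mkcond big_allpairs /=.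
apply: eq_big_nat => a ha; rewrite [RHS]big_mkcond /=; apply: eq_big_nat => b hb.
case: ifP => // /eqP ab; rewrite index_of_canonical_class //.
by split=> //; rewrite !modn2 ab.
Qed.

End Parametrization.

(** * The sum of the inverse torsions *)

Lemma coprime_odd p q : coprime p q -> odd p || odd q.
Proof.
move=> pq; apply: contraLR pq; rewrite negb_or => /andP[p2 q2].
have : (2 %| gcdn p q)%N by rewrite dvdn_gcd !dvdn2 p2 q2.
by rewrite /coprime => h; apply/eqP => g1; rewrite g1 in h.
Qed.

(** For n > 1 the range reduces to l = 0, leaving C(2, 1). *)
Lemma alt_binom_sum1 n : (2 <= n)%N -> alt_binom_sum n 1 = 2.
Proof.
move=> n2; rewrite alt_binom_sumE; last by lia.
by rewrite /binom_half_sum divn_small // big_geq // mulr0 addr0.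
Qed.

Lemma torsion_weight (R : realType) (p q m a b : nat) (eps : R[i]) :
  1 / (eps * (p * q)%:R /
    (16 * sin (a%:R * pi / p%:R) ^+ 2 * sin (b%:R * pi / q%:R) ^+ 2)%:C%C) ^+ m =
  (eps * (p * q)%:R) ^- m * ((sin_weight R p m a)%:C%C * (sin_weight R q m b)%:C%C).
Proof.
rewrite div1r -exprVn invf_div exprMn exprVn mulrC; congr (_ * _).
rewrite -rmorphXn -rmorphM /= -exprMn; congr (_ ^+ _)%:C%C.
by rewrite ![pi * _]mulrC; ring.
Qed.

Theorem mainTheorem5 (R : realType) (p q : nat) (r s : int) (c eps : R[i])
    (p_ge2 : (2 <= p)%N) (q_ge2 : (2 <= q)%N) (pq_coprime : coprime p q)
    (rs_eq : p%:Z * s - q%:Z * r = 1)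
    (c_neq : forall a b : nat, component_index p q a b ->
       c <> (2 * cos (pi * (r%:~R * a%:R / p%:R + s%:~R * b%:R / q%:R)))%:C%C /\
       c <> (2 * cos (pi * (r%:~R * a%:R / p%:R - s%:~R * b%:R / q%:R)))%:C%C)
    (eps_sign : eps = 1 \/ eps = -1) :
  let classes := @irrep_classes_trace R p q (meridian p q r s) c in
  let tau := @adjoint_torsion R p q eps in
  [/\ finite_set classes,
      forall m : nat, (0 < m)%N ->
        let value : R[i] :=
          1 / (2 * (p * q)%:R ^+ (m - 1)%N)
            * (alt_binom_sum p m)%:~R * (alt_binom_sum q m)%:~R in
        eps ^+ m * (\sum_(K \in classes) 1 / tau K ^+ m) = value /\
        exists k : int, value = 2 / (p * q)%:R ^+ (m - 1)%N * k%:~R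
    & \sum_(K \in classes) 1 / tau K = 2 \/
      \sum_(K \in classes) 1 / tau K = -2].
Proof.
move=> classes tau.
have p0 : (0 < p)%N by lia.
have q0 : (0 < q)%N by lia.
have eps0 : eps != 0 by case: eps_sign => ->; rewrite ?oppr_eq0 oner_eq0.
have p0' : p%:R != 0 :> R[i] by rewrite pnatr_eq0; lia.
have q0' : q%:R != 0 :> R[i] by rewrite pnatr_eq0; lia.
have two0 : 2 != 0 :> R[i] by rewrite pnatr_eq0.
have sumE m : (0 < m)%N -> eps ^+ m * (\sum_(K \in classes) 1 / tau K ^+ m) =
    1 / (2 * (p * q)%:R ^+ (m - 1)%N) * (alt_binom_sum p m)%:~R * (alt_binom_sum q m)%:~R.
  move=> m0.
  (* The summand depends on the class only through its index, so the sum can be transferred to pairs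
     (a, b). *)
  pose f (ab : nat * nat) : R[i] := 1 / (let: (a, b) := ab in eps * (p * q)%:R /
    (16 * sin (a%:R * pi / p%:R) ^+ 2 * sin (b%:R * pi / q%:R) ^+ 2)%:C%C) ^+ m.
  rewrite (sum_irrep_classes_trace p_ge2 q_ge2 rs_eq c_neq f) /f.
  under eq_bigr => a _ do (under eq_bigr => b _ do rewrite torsion_weight; rewrite -mulr_sumr).
  rewrite -mulr_sumr; set S := (X in _ * (_ * X)).
  have : 2 * S = (p%:R * (alt_binom_sum p m)%:~R) * (q%:R * (alt_binom_sum q m)%:~R).
    rewrite -!sin_weight_sum //.
    apply: (parity_sum (f := fun a => (sin_weight R p m a)%:C%C)
                       (g := fun b => (sin_weight R q m b)%:C%C)) => [|a ha|b hb].
    - exact: coprime_odd.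
    - by rewrite sin_weight_sub //; lia.
    - by rewrite sin_weight_sub //; lia.
  move: (alt_binom_sum p m)%:~R (alt_binom_sum q m)%:~R S => A B S SE.
  have -> : S = p%:R * q%:R * A * B / 2.
    by apply: (mulfI two0); rewrite SE; field.
  (* Writing m = k + 1, one factor pq from the two sine sums cancels against (pq)^m and leaves
     (pq)^k; the powers of eps cancel. *)
  case: m m0 {f SE S} => // k _; rewrite subn1 natrM exprMn (exprS (_ * _)).
  have := expf_neq0 k.+1 eps0; have := expf_neq0 k (mulf_neq0 p0' q0').
  move: (_ ^+ k) (_ ^+ k.+1) => N e N0 e0.
  by field; rewrite N0 e0 p0' q0'.
have even_value m : (0 < m)%N -> exists k : int,
    1 / (2 * (p * q)%:R ^+ (m - 1)%N) * (alt_binom_sum p m)%:~R * (alt_binom_sum q m)%:~R =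
    2 / (p * q)%:R ^+ (m - 1)%N * k%:~R :> R[i].
  move=> m0; have [k ->] := alt_binom_sum_even p0 m0; have [l ->] := alt_binom_sum_even q0 m0.
  exists (k * l); rewrite natrM !rmorphM /=.
  have := expf_neq0 (m - 1) (mulf_neq0 p0' q0'); move: (_ ^+ (m - 1)) => P P0.
  by field; rewrite P0.
split.
- rewrite /classes (irrep_classes_traceE p_ge2 q_ge2 rs_eq c_neq).
  by apply: finite_image; exact: finite_seq.
- by move=> m m0 value; split; [exact: sumE | exact: even_value].
(* For m = 1 both alternating sums are 2, so the value is 1/2 * 2 * 2 = 2, and eps only affects the
   sign. *)
have := sumE 1%N isT; rewrite expr1 subnn expr0 mulr1 !alt_binom_sum1 //.
under eq_fsbigr do rewrite expr1.
have -> : 1 / 2 * 2%:~R * 2%:~R = 2 :> R[i] by field.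
move: (\sum_(_ \in _) _) => S.
by case: eps_sign => ->; rewrite ?mul1r ?mulN1r => SE; [left | right; rewrite -SE opprK].
Qed.
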